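(* Let $n\ge1$, $\mathfrak{a}=(a_1,\dots,a_n)\in\mathbb{R}_{>0}^n$, and $P_k(x_1,\dots,x_n)=k-P(x_1,\dots,x_n)\in\mathbb{C}[x_1^{\pm1},\dots,x_n^{\pm1}]$ for $k\in\mathbb{C}$, where $P$ has no constant term. Let $\mathcal{K}_{\mathfrak{a}}=\{P(x_1,\dots,x_n):|x_j|=a_j\ \forall j\}$, let $U_{\mathfrak{a}}$ be the unbounded open connected component of $\mathbb{C}\setminus\mathcal{K}_{\mathfrak{a}}$ (containing a neighbourhood of $k=\infty$), and define $U_{\mathfrak{1}}$ likewise for $\mathfrak{1}=(1,\dots,1)$. For $j=1,\dots,n$ let $\nu^j_{\mathfrak{a},k}$ be the number of zeros (with multiplicity) of the one-variable Laurent polynomial $x_j\mapsto P_k(a_1,\dots,a_{j-1},x_j,a_{j+1},\dots,a_n)$ in $0<|x_j|<a_j$ minus the order of its pole at $x_j=0$. Then for $k\in U_{\mathfrak{a}}\cap U_{\mathfrak{1}}$, $$\mathrm{m}_{\mathfrak{a}}(P_k)=\mathrm{m}(P_k)+\sum_{j=1}^n\nu^j_{\mathfrak{a},k}\log a_j,$$ and, for $k\in U_{\mathfrak{a}}\cap U_{\mathfrak{1}}$ and each $j$, $\nu^j_{\mathfrak{a},k}$ does not depend on $k$ (it depends only on $\mathfrak{a}$).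
   Context: For nonzero $F\in\mathbb{C}(x_1,\dots,x_n)$ and $\mathfrak{a}\in\mathbb{R}_{>0}^n$, $\mathrm{m}_{\mathfrak{a}}(F)=\frac{1}{(2\pi i)^n}\int_{\mathbb{T}^n_{\mathfrak{a}}}\log|F|\frac{dx_1}{x_1}\cdots\frac{dx_n}{x_n}$, $\mathbb{T}^n_{\mathfrak{a}}=\{(x_1,\dots,x_n)\in(\mathbb{C}^* )^n:|x_j|=a_j\ \forall j\}$, and $\mathrm{m}=\mathrm{m}_{\mathfrak{1}}$. *)

(* Defs.v *)
From HB Require Import structures.
From mathcomp Require Import all_boot all_order all_algebra.
From mathcomp Require Import finmap complex.
From mathcomp Require Import monalg.
From mathcomp Require Import all_classical all_reals all_analysis.

Set Implicit Arguments.
Unset Strict Implicit.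
Unset Printing Implicit Defensive.

Import Order.TTheory GRing.Theory Num.Theory.
Import ComplexField.Normc.
Import numFieldNormedType.Exports.

Local Open Scope classical_set_scope.
Local Open Scope ring_scope.
Local Open Scope complex_scope.

Section TupleLebesgue.
Context {R : realType}.

Section Step.
Local Notation MR := (measurableTypeR R).
Context (n : nat) (m : {sigma_finite_measure set (n.-tuple MR) -> \bar R}).

Definition tuple_cons (x : MR * n.-tuple MR) : n.+1.-tuple MR :=
  [tuple of x.1 :: x.2].

Lemma measurable_tuple_cons : measurable_fun setT tuple_cons.
Proof. exact: measurable_cons. Qed.

(* The product of Lebesgue measure on R and of m, transported to (n+1)-tuples. *)
Definition lebesgue_cons : set (n.+1.-tuple MR) -> \bar R :=
  pushforward (@lebesgue_measure R \x m)%E tuple_cons.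

Let lebesgue_cons0 : lebesgue_cons set0 = 0%E.
Proof. by rewrite /lebesgue_cons /pushforward preimage_set0 measure0. Qed.

Let lebesgue_cons_ge0 A : (0 <= lebesgue_cons A)%E.
Proof. exact: (measure_ge0 (@lebesgue_measure R \x m)%E). Qed.

Let lebesgue_cons_sigma_additive : semi_sigma_additive lebesgue_cons.
Proof.
exact: (@measure_semi_sigma_additive _ _ _
  (measure_function_pushforward__canonical__measure_function_Measure
    (@lebesgue_measure R \x m)%E measurable_tuple_cons)).
Qed.

HB.instance Definition _ := isMeasure.Build _ _ _ lebesgue_cons
  lebesgue_cons0 lebesgue_cons_ge0 lebesgue_cons_sigma_additive.

Let lebesgue_cons_sigma_finite : sigma_finite setT lebesgue_cons.
Proof.
have /sigma_finiteP[F [TF ndF Foo]] := sigma_finiteT (@lebesgue_measure R).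
have /sigma_finiteP[G [TG ndG Goo]] := sigma_finiteT m.
pose g (t : n.+1.-tuple MR) : MR * n.-tuple MR :=
  (thead t, [tuple of behead t]).
have gK : g \o tuple_cons = id.
  by apply/funext => -[x t] /=; congr pair; apply: val_inj.
have mg : measurable_fun setT g.
  apply/measurable_fun_pair; first exact: measurable_tnth.
  exact: measurable_behead.
exists (fun k => g @^-1` (F k `*` G k)).
  rewrite -preimage_bigcup -[LHS](preimage_setT g); congr (_ @^-1` _).
  rewrite -setXTT TF TG predeqE => -[x y]; split.
    move=> [/= [i _ Fix] [k _ Gky]]; exists (maxn i k) => //; split.
    - by move: x Fix; exact/subsetPset/ndF/leq_maxl.
    - by move: y Gky; exact/subsetPset/ndG/leq_maxr.
  by move=> [i _ []/= ? ?]; split; exists i.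
move=> k; have [mF ?] := Foo k; have [mG ?] := Goo k; split.
  by rewrite -[X in measurable X]setTI; apply: mg => //; exact: measurableX.
rewrite /lebesgue_cons /pushforward -comp_preimage gK preimage_id.
by rewrite product_measure1E// lte_mul_pinfty// ge0_fin_numE.
Qed.

HB.instance Definition _ := Measure_isSigmaFinite.Build _ _ _ lebesgue_cons
  lebesgue_cons_sigma_finite.
End Step.

Fixpoint lebesgue_tuple (n : nat) :
    {sigma_finite_measure set (n.-tuple (measurableTypeR R)) -> \bar R} :=
  match n with
  | 0%N => \d_([tuple] : 0.-tuple (measurableTypeR R))
  | k.+1 => lebesgue_cons (lebesgue_tuple k)
  end.
End TupleLebesgue.

(* The finitely supported function m |-> P@_m is the coefficient family: P is
   the sum of the P@_m x_1^(m 1) ... x_n^(m n). *)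
Definition laurent (R : realType) (n : nat) : Type :=
  {malg R[i][{ffun 'I_n -> int}]}.

Section Mahler.
Context {R : realType} {n : nat}.
Local Notation C := R[i].

Definition torus (a : 'I_n -> R) : set ('I_n -> C) :=
  [set x | forall j, `|x j| = (a j)%:C].

Definition angles : set (n.-tuple (measurableTypeR R)) :=
  [set t | forall j, 0 <= tnth t j <= 2 * pi].

Definition torus_point (a : 'I_n -> R) (t : n.-tuple (measurableTypeR R)) :
    'I_n -> C :=
  fun j => (a j)%:C * (cos (tnth t j) +i* sin (tnth t j)).

(* With x_j = a_j e^(i t_j) one has dx_j / x_j = i dt_j, so the factors i of
   (2 pi i)^-n cancel. *)
Definition mahler (a : 'I_n -> R) (F : ('I_n -> C) -> C) : R :=
  (2 * pi) ^- n *
  \int[lebesgue_tuple n]_(t in angles) ln (normc (F (torus_point a t))).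

Definition laurent_eval (P : laurent R n) (x : 'I_n -> C) : C :=
  \sum_(m <- msupp P) P@_m * \prod_(j < n) x j ^ m j.

Definition pencil (P : laurent R n) (k : C) : laurent R n :=
  << k *g (0 : {ffun 'I_n -> int}) >> - P.

(* The Laurent polynomial in one variable obtained from P by specializing
   every variable but the j-th one at x; monomials of P with the same exponent
   at j are collected. *)
Definition laurent_slice (P : laurent R n) (x : 'I_n -> C) (j : 'I_n) :
    {malg C[int]} :=
  \sum_(m <- msupp P) << P@_m * \prod_(i < n | i != j) x i ^ m i *g m j >>.

End Mahler.

Section LaurentZeros.
Context {R : realType}.
Local Notation C := R[i].

(* 0 when f has no pole at 0. *)
Definition pole_order (f : {malg C[int]}) : nat :=
  \max_(e <- msupp f | (e < 0)%R) absz e.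

(* X^(pole_order f) f, a polynomial with the same zeros as f in C^*. *)
Definition numerator (f : {malg C[int]}) : {poly C} :=
  \sum_(e <- msupp f) f@_e *: 'X^(absz (e + (pole_order f)%:Z)).

Definition zeros_count (f : {malg C[int]}) (r : R) : nat :=
  \sum_(z \in [set z : C | 0 < `|z| < r%:C]) mup z (numerator f).

Definition zeros_minus_poles (f : {malg C[int]}) (r : R) : int :=
  (zeros_count f r)%:Z - (pole_order f)%:Z.

End LaurentZeros.

Section UnboundedComponent.
Context {R : realType}.

(* The union of the unbounded connected components of the complement of K; for
   compact K there is exactly one such component. R[i]^o carries the topology
   of the complex modulus. *)
Definition unbounded_component (K : set R[i]^o) : set R[i]^o :=
  [set k | ~ K k /\ ~ bounded_set (connected_component (~` K) k)].

End UnboundedComponent.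

Section Statement.
Context {R : realType} {n : nat}.
Local Notation C := R[i].

Definition torus_image (P : laurent R n) (a : 'I_n -> R) : set C :=
  laurent_eval P @` torus a.

Definition nu (P : laurent R n) (a : 'I_n -> R) (k : C) (j : 'I_n) : int :=
  zeros_minus_poles (laurent_slice (pencil P k) (fun i => (a i)%:C) j) (a j).

End Statement.

(* Main.v *)
(* All the nu^j vanish on U_a, so the content is m_a(P_k) = m(P_k).  For k in U_a join k to
   infinity by a finite chain of small steps avoiding K_a; by Rouche's theorem at each step, k - P
   has winding number 0 along every monomial curve y |-> (a_j y^(d_j) e^(i t_j)), |y| = 1.  Given a
   small h > 0, write log a = v + h d with d integral and 0 <= v_j < h.  For b = exp v close to 1,
   k is still joined to infinity off K_b, so for every t the Laurent polynomial
   y |-> (k - P)(b_j y^(d_j) e^(i t_j)) has winding number 0 on |y| = 1 and on |y| = e^h; hence it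
   has no zero in between, and by Jensen's formula its logarithmic means over both circles agree.
   Taking these means over roots of unity and integrating over t gives m_a(P_k) = m_b(P_k) by
   translation invariance of the torus integral; finally b -> 1 as h -> 0. *)
Require Import Defs.
From mathcomp Require Import all_boot all_order all_algebra.
From mathcomp Require Import finmap complex.
From mathcomp Require Import monalg.
From mathcomp Require Import all_classical all_reals all_analysis.
From mathcomp Require Import measurable_realfun.
From mathcomp Require Import zify ring lra.

Set Implicit Arguments.
Unset Strict Implicit.
Unset Printing Implicit Defensive.

Import Order.TTheory GRing.Theory Num.Theory.
Import ComplexField.Normc.
Import numFieldNormedType.Exports.

Local Open Scope classical_set_scope.
Local Open Scope ring_scope.
Local Open Scope complex_scope.

(** * The modulus and polar coordinates *)

(** Nothing is assumed about k on the tori between the two given ones, so k - P cannot simply be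
    followed from one to the other. Only the two ends are controlled, and the root counts there must
    exclude zeros in between: equal counts in two concentric discs leave none for the annulus. The
    curve is single valued only for integral exponents, whence the rounding of log a to a multiple
    of h; the remainder is left to continuity, so being joined to infinity has to survive small
    perturbations of the image. No contour integral occurs. The argument principle and Jensen's
    formula are replaced by means over the n-th roots of unity, which partial fractions and X^n - 1
    evaluate in closed form. Such a mean along a monomial curve is also an average of finitely many
    translates on the torus, which is what translation invariance can handle. *)

Section Modulus.
Context {R : realType}.
Local Notation C := R[i].
Implicit Types (x y z : C) (u t : R).

Lemma normcE_norm x : `|x| = (normc x)%:C.
Proof. by rewrite normc_def; case: x. Qed.

Lemma normc_ge0 x : 0 <= normc x.
Proof. by case: x => a b; rewrite /normc sqrtr_ge0. Qed.

Lemma normc_eq0 x : (normc x == 0) = (x == 0).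
Proof.
apply/eqP/eqP => [|->]; first exact: ComplexField.Normc.eq0_normc.
exact: ComplexField.Normc.normc0.
Qed.

Lemma normc_gt0 x : (0 < normc x) = (x != 0).
Proof. by rewrite lt_def normc_ge0 andbT normc_eq0. Qed.

Lemma ler_normcD x y : normc (x + y) <= normc x + normc y.
Proof. exact: le_normcD. Qed.

Lemma normcN x : normc (- x) = normc x.
Proof. exact: complex.normcN. Qed.

Lemma normcBC x y : normc (x - y) = normc (y - x).
Proof. by rewrite -normcN opprB. Qed.

Lemma ler_normcB x y : normc (x - y) <= normc x + normc y.
Proof. by rewrite -(normcN y); exact: ler_normcD. Qed.

Lemma lerB_normc x y : normc x - normc y <= normc (x - y).
Proof. by rewrite lerBlDr; have := ler_normcD (x - y) y; rewrite subrK. Qed.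

Lemma normcf_div x y : normc (x / y) = normc x / normc y.
Proof. by rewrite normcM normcV. Qed.

Lemma normcX x n : normc (x ^+ n) = normc x ^+ n.
Proof.
by elim: n => [|n IH]; rewrite ?expr0 ?normc1// !exprS normcM IH.
Qed.

Lemma normc_real u : normc u%:C = `|u|.
Proof. by rewrite /normc /= expr0n addr0 sqrtr_sqr. Qed.

Lemma normc_nat n : normc (n%:R : C) = n%:R.
Proof. by rewrite -(rmorph_nat (real_complex R)) normc_real normr_nat. Qed.

Lemma ler_normc_sum (I : Type) (s : seq I) (P : pred I) (F : I -> C) :
  normc (\sum_(i <- s | P i) F i) <= \sum_(i <- s | P i) normc (F i).
Proof.
elim/big_rec2: _ => [|i a b _ h]; first by rewrite normc0.
by apply: le_trans (ler_normcD _ _) _; rewrite lerD2l.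
Qed.

Lemma normc_prod (I : Type) (s : seq I) (P : pred I) (F : I -> C) :
  normc (\prod_(i <- s | P i) F i) = \prod_(i <- s | P i) normc (F i).
Proof.
elim/big_rec2: _ => [|i a b _ h]; first by rewrite normc1.
by rewrite normcM h.
Qed.

Lemma ler_normc_ReIm x : normc x <= `|complex.Re x| + `|complex.Im x|.
Proof.
case: x => a b /=; rewrite -(@ler_pXn2r _ 2) ?nnegrE ?sqrtr_ge0 ?addr_ge0//.
rewrite sqr_sqrtr ?addr_ge0 ?sqr_ge0// sqrrD !real_normK ?num_real//.
by rewrite addrAC lerDl mulrn_wge0// mulr_ge0.
Qed.

(** This is exp(u + it). With the logarithm of the modulus as coordinate, monomials become additive
    in both arguments. *)
Definition polar u t : C := (expR u)%:C * (cos t +i* sin t).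

Lemma polarD u t u' t' : polar (u + u') (t + t') = polar u t * polar u' t'.
Proof.
rewrite /polar expRD cosD sinD rmorphM /= -!mulrA; congr (_ * _).
rewrite mulrCA; congr (_ * _).
by apply/eqP; rewrite eq_complex /=; apply/andP; split; apply/eqP; ring.
Qed.

Lemma polar0 : polar 0 0 = 1.
Proof. by rewrite /polar expR0 cos0 sin0 mul1r. Qed.

Lemma normc_polar u t : normc (polar u t) = expR u.
Proof.
by rewrite normcM normc_real ger0_norm ?expR_ge0// /normc cos2Dsin2 sqrtr1 mulr1.
Qed.

Lemma polar_neq0 u t : polar u t != 0.
Proof. by rewrite -normc_gt0 normc_polar expR_gt0. Qed.

Lemma polar_exprn u t n : polar u t ^+ n = polar (n%:R * u) (n%:R * t).
Proof.
elim: n => [|n IH]; first by rewrite expr0 !mul0r polar0.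
by rewrite exprS IH -polarD -!natr1 !mulrDl !mul1r ![_ + u]addrC ![_ + t]addrC.
Qed.

Lemma polarN u t : polar (- u) (- t) = (polar u t)^-1.
Proof.
apply: (mulfI (polar_neq0 u t)).
by rewrite mulfV ?polar_neq0// -polarD !subrr polar0.
Qed.

Lemma polar_exprz u t (m : int) : polar u t ^ m = polar (m%:~R * u) (m%:~R * t).
Proof.
case: m => n; first by rewrite -exprnP polar_exprn.
by rewrite NegzE -exprnN polar_exprn -polarN !mulrNz !mulNr.
Qed.

Lemma polar_prod (I : Type) (s : seq I) (P : pred I) (f g : I -> R) :
  \prod_(i <- s | P i) polar (f i) (g i) =
  polar (\sum_(i <- s | P i) f i) (\sum_(i <- s | P i) g i).
Proof. by elim/big_rec3: _ => [|i a b c _ ->]; rewrite ?polar0// polarD. Qed.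

Lemma polar_period u t (m : int) : polar u (t + 2 * pi * m%:~R) = polar u t.
Proof.
rewrite -[u in LHS]addr0 polarD; suff -> : polar 0 (2 * pi * m%:~R) = 1.
  by rewrite mulr1.
have -> : polar 0 (2 * pi * m%:~R) = polar 0 (2 * pi) ^ m.
  by rewrite polar_exprz mulr0 [m%:~R * _]mulrC.
suff -> : polar 0 (2 * pi) = 1 by rewrite exp1rz.
by rewrite /polar expR0 mul1r mulrC mulr_natr -[_ *+ 2]add0r cosD2pi sinD2pi cos0 sin0.
Qed.

Lemma polar_surj x u : normc x = expR u ->
  exists t, 0 <= t <= 2 * pi /\ x = polar u t.
Proof.
move=> nx; pose c := complex.Re x / expR u; pose s := complex.Im x / expR u.
have e0 : expR u != 0 by rewrite gt_eqF// expR_gt0.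
have cs : c ^+ 2 + s ^+ 2 = 1.
  rewrite /c /s !expr_div_n -mulrDl -nx.
  have -> : complex.Re x ^+ 2 + complex.Im x ^+ 2 = normc x ^+ 2.
    by rewrite /normc; case: (x) => a b /=; rewrite sqr_sqrtr// addr_ge0 ?sqr_ge0.
  by rewrite divff// expf_neq0// nx.
have xE t : cos t = c -> sin t = s -> x = polar u t.
  move=> ct st; apply/eqP; rewrite eq_complex /polar /= ct st !mul0r subr0 addr0.
  by rewrite /c /s !mulrA ![expR u * _]mulrC !mulfK// !eqxx.
have c1 : -1 <= c <= 1.
  rewrite -ler_norml -(@ler_pXn2r _ 2) ?nnegrE// expr1n real_normK ?num_real//.
  by rewrite -cs lerDl sqr_ge0.
have pi0 := pi_ge0 R.
have a0 := acos_ge0 c1; have ap := acos_lepi c1.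
have ss : sin (acos c) = `|s|.
  by rewrite sin_acos// -[1]cs addrAC subrr add0r sqrtr_sqr.
(* [acos] takes values in [0, pi], where the sine is nonnegative; a negative s is reached by the
   reflected angle. *)
have [s0|s0] := leP 0 s.
  exists (acos c); split; first lra.
  by apply: xE; rewrite ?acosK ?ss ?ger0_norm// in_itv.
exists (2 * pi - acos c); split; first lra.
have e2 : 2 * pi - acos c = - acos c + pi *+ 2 by rewrite mulr2n; ring.
apply: xE; rewrite e2 ?cosD2pi ?sinD2pi ?cosN ?sinN ?acosK ?ss ?in_itv//.
by rewrite ltr0_norm// opprK.
Qed.

End Modulus.

(** * Sums and products over roots of unity *)

Section PolynomialRoots.

Lemma horner_prod_seq (F : fieldType) (s : seq F) (z : F) :
  (\prod_(a <- s) ('X - a%:P)).[z] = \prod_(a <- s) (z - a).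
Proof. by rewrite horner_prod; apply: eq_bigr => a _; rewrite hornerXsubC. Qed.

Lemma log_deriv_prod (F : fieldType) (s : seq F) (z : F) :
  (forall a, a \in s -> a != z) ->
  (\prod_(a <- s) ('X - a%:P))^`().[z] =
  (\prod_(a <- s) ('X - a%:P)).[z] * \sum_(a <- s) (z - a)^-1.
Proof.
elim: s => [|a s IH] H; first by rewrite !big_nil derivC horner0 mulr0.
rewrite !big_cons derivM derivXsubC mul1r hornerD !hornerM IH; last first.
  by move=> b bs; apply: H; rewrite inE bs orbT.
have za : z - a != 0 by rewrite subr_eq0 eq_sym H// inE eqxx.
rewrite hornerXsubC mulrDr mulrA; congr (_ + _).
by rewrite mulrAC mulfV// mul1r.
Qed.

(** The factorization of X^n - 1, evaluated at z / x and cleared of denominators; hence the separate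
    case x = 0. *)
Lemma prod_prim_root (F : fieldType) n (w x z : F) : n.-primitive_root w ->
  \prod_(i < n) (z - x * w ^+ i) = z ^+ n - x ^+ n.
Proof.
move=> pw; have n0 := prim_order_gt0 pw; have [->|x0] := eqVneq x 0.
  rewrite expr0n gtn_eqF// subr0 (eq_bigr (fun=> z)); last by move=> i _; rewrite mul0r subr0.
  by rewrite prodr_const card_ord.
have := congr1 (fun p : {poly F} => p.[z / x]) (factor_Xn_sub_1 pw).
rewrite big_mkord horner_prod hornerD hornerN hornerXn hornerC => /(congr1 ( *%R (x ^+ n))).
rewrite mulrBr mulr1 expr_div_n mulrCA mulfV ?expf_neq0// mulr1 => <-.
rewrite -[X in x ^+ X]card_ord -prodr_const -big_split /=; apply: eq_bigr => i _.
by rewrite hornerXsubC mulrBr mulrCA mulfV// mulr1.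
Qed.

(** With y = x w^i, the quotient y / (y - z) is the sum of the y^(n-k) z^k over k < n, divided by
    x^n - z^n. After summation over i the terms with k > 0 disappear, because the powers of a
    nontrivial n-th root of unity add up to 0. *)
Lemma sum_prim_root (F : fieldType) n (w x z : F) : n.-primitive_root w ->
  x ^+ n != z ^+ n ->
  \sum_(i < n) x * w ^+ i / (x * w ^+ i - z) = n%:R * (x ^+ n / (x ^+ n - z ^+ n)).
Proof.
move=> pw xz; have n0 := prim_order_gt0 pw.
have xz0 : x ^+ n - z ^+ n != 0 by rewrite subr_eq0.
have yn (i : 'I_n) : (x * w ^+ i) ^+ n = x ^+ n.
  by rewrite exprMn exprAC (prim_expr_order pw) expr1n mulr1.
have nz (i : 'I_n) : x * w ^+ i - z != 0.
  by rewrite subr_eq0; apply: contraNneq xz => yz; rewrite -(yn i) yz.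
have w0 (k : nat) : (0 < k < n)%N -> \sum_(i < n) (w ^+ k) ^+ i = 0.
  move=> /andP[k0 kn]; have wk : w ^+ k - 1 != 0.
    rewrite subr_eq0 -(prim_order_dvd pw); apply/negP => /dvdn_leq -/(_ k0).
    by rewrite leqNgt kn.
  apply: (mulfI wk); rewrite mulr0 -subrX1 exprAC (prim_expr_order pw).
  by rewrite expr1n subrr.
have E (i : 'I_n) : x * w ^+ i / (x * w ^+ i - z) =
    (\sum_(k < n) (x * w ^+ i) ^+ (n - k) * z ^+ k) / (x ^+ n - z ^+ n).
  apply/eqP; rewrite eqr_div// -(yn i) subrXX; apply/eqP.
  rewrite [RHS]mulrC mulrCA; congr (_ * _).
  rewrite mulr_sumr; apply: eq_bigr => k _.
  by rewrite mulrA -exprS -subSn ?prednK// -ltnS prednK.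
rewrite (eq_bigr _ (fun i _ => E i)) -mulr_suml mulrA; congr (_ / _).
rewrite exchange_big /= (bigD1 (Ordinal n0)) //= [X in _ + X]big1 ?addr0.
  under eq_bigr do rewrite subn0 yn mulr1.
  by rewrite sumr_const card_ord mulr_natl.
move=> k k0; rewrite -mulr_suml.
under eq_bigr do rewrite exprMn exprAC.
rewrite -mulr_sumr w0 ?mulr0 ?mul0r// subn_gt0 ltn_ord /=.
rewrite -[X in (_ < X)%N]subn0 ltn_sub2l// lt0n.
by apply: contraNneq k0 => k0; apply/eqP/val_inj.
Qed.

End PolynomialRoots.

(** * Counting roots in a disc *)

Section Rouche.
Context {R : realType}.
Local Notation C := R[i].
Implicit Types (x y z : C) (p q : {poly C}) (r e : R).

Definition unity_gen n : C := polar 0 (2 * pi / n%:R).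

Lemma unity_gen_prim n : (0 < n)%N -> n.-primitive_root (unity_gen n).
Proof.
move=> n0; have nR : (n%:R : R) != 0 by rewrite pnatr_eq0 -lt0n.
have wE k : unity_gen n ^+ k = polar 0 (2 * pi * (k%:R / n%:R)).
  by rewrite polar_exprn mulr0; congr (polar _ _); rewrite mulrCA.
apply/andP; split => //; apply/forallP => i; rewrite unity_rootE wE.
have pi0 := pi_gt0 R; set a := _ / _.
have a0 : 0 < a by rewrite divr_gt0// ltr0n.
have a1 : a <= 1 by rewrite ler_pdivrMr ?ltr0n// mul1r ler_nat.
have aE : (a == 1) = (i.+1 == n).
  by rewrite /a -(inj_eq (mulIf nR)) mulfVK// mul1r eqr_nat.
rewrite -aE; have [->|an1] := eqVneq a 1.
  by rewrite -[X in polar _ X]add0r -[1]/(1%:~R : R) polar_period polar0 eqxx.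
rewrite eqbF_neg; apply/eqP => /(congr1 (@complex.Re R)) /=.
rewrite expR0 mul0r subr0 mul1r => c1.
(* For 0 < a < 1 the half angle has positive sine, so cos (2 pi a) = 1 - 2 sin^2 (pi a) cannot be
   1. *)
have s0 : 0 < sin (pi * a).
  by apply: sin_gt0_pi; rewrite mulr_gt0//= gtr_pMr// lt_neqAle an1.
have : cos (pi * a + pi * a) = 1 by rewrite -c1; congr cos; ring.
rewrite cosD => c2; have cs := cos2Dsin2 (pi * a).
move: s0 cs c2; set s := sin _; set c := cos _ => *; nra.
Qed.

Lemma normc_unity_gen n k : normc (unity_gen n ^+ k) = 1.
Proof. by rewrite normcX normc_polar expR0 expr1n. Qed.

Lemma expr_small r e : 0 <= r < 1 -> 0 < e -> exists n0, forall n, (n0 <= n)%N -> r ^+ n <= e.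
Proof.
move=> /andP[r0 r1] e0.
have : r ^+ n @[n --> \oo] --> (0 : R) by apply: cvg_expr; rewrite ger0_norm.
move=> /cvgrPdist_le /(_ _ e0) [n0 _ H]; exists n0 => n /H /=.
by rewrite sub0r normrN ger0_norm// exprn_ge0.
Qed.

(** High powers separate the two sides of the circle: z^n is negligible against r^n when z is
    inside, and r^n against z^n when z is outside. The indicator of the disc thus arises as a
    limit. *)
Lemma pow_ratio_cvg r z e : 0 < r -> normc z != r -> 0 < e ->
  exists n0, forall n, (n0 <= n)%N -> (r%:C ^+ n != z ^+ n) /\
  normc (r%:C ^+ n / (r%:C ^+ n - z ^+ n) - (normc z < r)%R%:R) <= e.
Proof.
move=> r0 zr e0.
have key (u v : C) d : 0 < d < 1 -> normc u <= d * normc v -> v != 0 ->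
    v - u != 0 /\ normc (u / (v - u)) <= d / (1 - d).
  move=> /andP[d0 d1] uv v0; have nv : 0 < normc v by rewrite normc_gt0.
  have h : (1 - d) * normc v <= normc (v - u).
    by apply: le_trans (lerB_normc v u); rewrite mulrBl mul1r lerB.
  have h0 : 0 < normc (v - u) by apply: lt_le_trans h; rewrite mulr_gt0// subr_gt0.
  split; first by rewrite -normc_gt0.
  rewrite normcf_div ler_pdivrMr// (le_trans uv)//.
  by rewrite mulrAC ler_pdivlMr ?subr_gt0// -mulrA ler_pM2l// mulrC.
(* Together d <= 1/2 and d <= e/2 give d / (1 - d) <= e. *)
pose d := Num.min (1 / 2) (e / 2).
have d0 : 0 < d by rewrite /d lt_min; apply/andP; split; lra.
have [d1 d2] : d <= 1 / 2 /\ d <= e / 2 by rewrite /d !ge_min !lexx orbT.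
have de : d / (1 - d) <= e by rewrite ler_pdivrMr; [nra|lra].
have d01 : 0 < d < 1 by apply/andP; split; lra.
have rC0 : r%:C != 0 :> C by rewrite -normc_gt0 normc_real gtr0_norm.
have [zlt|zge] := ltP (normc z) r.
- have [] := @expr_small (normc z / r) d => //.
    by rewrite divr_ge0 ?normc_ge0 1?ltW//= ltr_pdivrMr// mul1r.
  move=> n0 H; exists n0 => n /H h.
  have [] := key (z ^+ n) (r%:C ^+ n) d => //.
  + rewrite !normcX normc_real gtr0_norm// -ler_pdivrMr ?exprn_gt0//.
    by rewrite -expr_div_n.
  + by rewrite expf_neq0.
  move=> nz hle; split; first by rewrite -subr_eq0.
  rewrite -[X in _ - X](mulfV nz) -mulrBl opprB addrC subrK.
  exact: le_trans hle de.
- have z0 : 0 < normc z by exact: lt_le_trans zge.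
  have [] := @expr_small (r / normc z) d => //.
    by rewrite divr_ge0 1?ltW//= ltr_pdivrMr// mul1r lt_neqAle eq_sym zr.
  move=> n0 H; exists n0 => n /H h.
  have [] := key (r%:C ^+ n) (z ^+ n) d => //.
  + rewrite !normcX normc_real gtr0_norm// -ler_pdivrMr ?exprn_gt0//.
    by rewrite -expr_div_n.
  + by rewrite expf_neq0// -normc_gt0.
  move=> nz hle; split; first by rewrite eq_sym -subr_eq0.
  rewrite subr0 normcf_div normcBC -normcf_div.
  exact: le_trans hle de.
Qed.

Lemma pow_ratio_sum_cvg r (s : seq C) e : 0 < r -> (forall z, z \in s -> normc z != r) ->
  0 < e -> exists n0, forall n, (n0 <= n)%N ->
  (forall z, z \in s -> r%:C ^+ n != z ^+ n) /\
  normc (\sum_(z <- s) r%:C ^+ n / (r%:C ^+ n - z ^+ n) -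
         (count (fun z => normc z < r)%R s)%:R) <= e.
Proof.
move=> r0; elim: s e => [|a s IH] e H e0.
  by exists 0%N => n _; split => //; rewrite big_nil subrr normc0 ltW.
have e2 : 0 < e / 2 by lra.
have [|n1 H1] := IH (e / 2) _ e2; first by move=> z zs; apply: H; rewrite inE zs orbT.
have [|n2 H2] := @pow_ratio_cvg r a (e / 2) r0 _ e2; first by apply: H; rewrite inE eqxx.
exists (maxn n1 n2) => n; rewrite geq_max => /andP[/H1 [h1 k1] /H2 [h2 k2]].
split; first by move=> z; rewrite inE => /predU1P[->//|/h1].
rewrite big_cons /= natrD opprD addrACA.
by apply: le_trans (ler_normcD _ _) _; rewrite (splitr e) lerD.
Qed.

Definition roots_seq p : seq C := sval (closed_field_poly_normal p).

Lemma roots_seqE p : p = lead_coef p *: \prod_(z <- roots_seq p) ('X - z%:P).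
Proof. exact: svalP (closed_field_poly_normal p). Qed.

(** The root 0 is counted, unlike in [zeros_count]: a factor x^D that clears poles has to contribute
    D. *)
Definition nroots p r := count (fun z => normc z < r)%R (roots_seq p).

Lemma roots_seq_root p z : z \in roots_seq p -> p.[z] = 0.
Proof.
move=> zs; rewrite [p]roots_seqE hornerZ horner_prod_seq (big_rem z)//=.
by rewrite subrr mul0r mulr0.
Qed.

(** A discrete argument principle. The logarithmic derivative is the sum of 1 / (x - z) over the
    roots z, and for each root the mean over the n sample points is r^n / (r^n - z^n), which tends
    to 1 inside the circle and to 0 outside. *)
Lemma mean_log_deriv p r e : 0 < r -> (forall x, normc x = r -> p.[x] != 0) -> 0 < e ->
  exists n0, forall n, (n0 <= n)%N -> (0 < n)%N ->
  normc (n%:R^-1 * \sum_(i < n) r%:C * unity_gen n ^+ i *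
     (p^`().[r%:C * unity_gen n ^+ i] / p.[r%:C * unity_gen n ^+ i]) -
     (nroots p r)%:R) <= e.
Proof.
move=> r0 pr e0; pose s := roots_seq p.
have p0 : p != 0.
  apply/eqP => p0; have := pr r%:C; rewrite p0 horner0 eqxx normc_real gtr0_norm//.
  by move=> /(_ erefl).
have lp : lead_coef p != 0 by rewrite lead_coef_eq0.
have sr z : z \in s -> normc z != r.
  by move=> zs; apply/negP => /eqP /pr; rewrite roots_seq_root ?eqxx.
have [n0 H] := pow_ratio_sum_cvg r0 sr e0.
exists n0 => n /H [rz h] n_gt0; apply: le_trans h.
rewrite le_eqVlt; apply/orP; left; apply/eqP; congr (normc (_ - _)).
rewrite -/s (eq_bigr (fun i : 'I_n => \sum_(z <- s)
    r%:C * unity_gen n ^+ i / (r%:C * unity_gen n ^+ i - z))); last first.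
  move=> i _; set x := r%:C * _.
  have nx : normc x = r by rewrite normcM normc_unity_gen mulr1 normc_real gtr0_norm.
  have px := pr _ nx.
  rewrite -mulr_sumr; congr (_ * _); rewrite [p]roots_seqE -/s derivZ !hornerZ.
  rewrite log_deriv_prod; last first.
    by move=> a /sr; apply: contraNneq => ->; rewrite nx.
  move: px; rewrite {1}[p]roots_seqE hornerZ -/s => px.
  by rewrite mulrA mulrAC mulfV// mul1r.
rewrite exchange_big /= (eq_big_seq (fun z => n%:R * (r%:C ^+ n / (r%:C ^+ n - z ^+ n)))).
  by rewrite -mulr_sumr mulKf// pnatr_eq0 -lt0n.
by move=> z zs; rewrite sum_prim_root ?rz//; exact: unity_gen_prim.
Qed.

Lemma horner_bounded p r : exists2 B, 0 < B & forall x, normc x = r -> normc p.[x] <= B.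
Proof.
exists (1 + `|\sum_(i < size p) normc p`_i * r ^+ i|); first by rewrite ltr_pwDl.
move=> x nx; rewrite horner_coef ler_wpDl//.
apply: le_trans (ler_normc_sum _ _ _) (le_trans _ (ler_norm _)).
by apply: ler_sum => i _; rewrite normcM normcX nx.
Qed.

(* Along the segment from q to p the mean of x f'(x) / f(x) over the circle is Lipschitz in the
   parameter, whereas its limit counts roots and is an integer. *)
Lemma rouche p q r m : 0 < r -> 0 < m ->
  (forall x, normc x = r -> normc (p.[x] - q.[x]) + m <= normc q.[x]) ->
  nroots p r = nroots q r.
Proof.
move=> r0 m0 pq; have [D pE] : exists D, p = q + D.
  by exists (p - q); rewrite addrC subrK.
pose f (s : R) := q + s%:C *: D.
have fx s x : (f s).[x] = q.[x] + s%:C * (p.[x] - q.[x]).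
  by rewrite pE !(hornerD, hornerZ) addrAC subrr add0r.
have fm s x : 0 <= s <= 1 -> normc x = r -> m <= normc (f s).[x].
  move=> /andP[s0 s1] /pq h; rewrite fx -[_ * _]opprK.
  apply: le_trans (lerB_normc _ _); rewrite normcN normcM normc_real ger0_norm//.
  have := normc_ge0 (p.[x] - q.[x]); nra.
have [B B0 HB] := horner_bounded (D^`() * q - D * q^`()) r.
pose L := r * B / m ^+ 2.
have L0 : 0 < L by rewrite divr_gt0 ?exprn_gt0// mulr_gt0.
have lip s s' x : 0 <= s <= 1 -> 0 <= s' <= 1 -> normc x = r ->
    normc (x * ((f s)^`().[x] / (f s).[x]) - x * ((f s')^`().[x] / (f s').[x]))
    <= L * `|s - s'|.
  move=> s01 s01' nx; have a := fm _ _ s01 nx; have b := fm _ _ s01' nx.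
  have a0 : (f s).[x] != 0 by rewrite -normc_gt0 (lt_le_trans m0).
  have b0 : (f s').[x] != 0 by rewrite -normc_gt0 (lt_le_trans m0).
  rewrite -mulrBr -mulNr addf_div// !normcM normcV normcM nx.
  (* The numerator of the difference is s - s' times a polynomial independent of both parameters; B
     bounds that polynomial on the circle, and m bounds both denominators from below. *)
  have -> : (f s)^`().[x] * (f s').[x] + - (f s')^`().[x] * (f s).[x] =
            (s - s')%:C * (D^`() * q - D * q^`()).[x].
    rewrite /f !derivD !derivZ !(hornerD, hornerN, hornerZ, hornerM).
    rewrite rmorphB /=; ring.
  rewrite normcM normc_real /L !mulrA.
  have B1 := HB x nx.
  rewrite ler_pdivrMr ?mulr_gt0 ?(lt_le_trans m0)//.
  have m2 : m ^+ 2 <= normc (f s).[x] * normc (f s').[x].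
    by rewrite expr2 ler_pM// ltW.
  have -> : r * B / m ^+ 2 * `|s - s'| * (normc (f s).[x] * normc (f s').[x]) =
     (r * `|s - s'| * B) * ((normc (f s).[x] * normc (f s').[x]) / m ^+ 2).
    by field; rewrite gt_eqF.
  rewrite -[X in X <= _]mulr1 ler_pM ?mulr_ge0 ?normc_ge0 ?(ltW r0)//.
    by rewrite ler_wpM2l// mulr_ge0// ltW.
  by rewrite ler_pdivlMr ?exprn_gt0// mul1r.
have step s s' : 0 <= s <= 1 -> 0 <= s' <= 1 -> L * `|s - s'| <= 1 / 2 ->
    nroots (f s) r = nroots (f s') r.
  move=> s01 s01' sL.
  have nzf t : 0 <= t <= 1 -> forall x, normc x = r -> (f t).[x] != 0.
    by move=> t01 x nx; rewrite -normc_gt0 (lt_le_trans m0)// fm.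
  (* Two errors of 1/8 and a variation of at most 1/2 stay below 1, which forces the two integers to
     agree. *)
  have e8 : 0 < (1 / 8 : R) by lra.
  have [n1 H1] := mean_log_deriv r0 (nzf s s01) e8.
  have [n2 H2] := mean_log_deriv r0 (nzf s' s01') e8.
  pose n := (maxn n1 n2).+1.
  have h1 := H1 n (leqW (leq_maxl _ _)) isT.
  have h2 := H2 n (leqW (leq_maxr _ _)) isT.
  move: h1; set S1 := n%:R^-1 * _ => h1; move: h2; set S2 := n%:R^-1 * _ => h2.
  have h3 : normc (S1 - S2) <= 1 / 2.
    apply: le_trans sL; rewrite -mulrBr -sumrB normcM normcV normc_nat.
    rewrite ler_pdivrMl ?ltr0n//.
    apply: le_trans (ler_normc_sum _ _ _) _.
    have -> : n%:R * (L * `|s - s'|) = \sum_(i < n) L * `|s - s'|.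
      by rewrite sumr_const card_ord mulr_natl.
    apply: ler_sum => i _; apply: lip => //.
    by rewrite normcM normc_unity_gen mulr1 normc_real gtr0_norm.
  have h4 : normc ((nroots (f s) r)%:R - (nroots (f s') r)%:R : C) < 1.
    have -> : (nroots (f s) r)%:R - (nroots (f s') r)%:R =
      (S2 - (nroots (f s') r)%:R) - (S1 - (nroots (f s) r)%:R) + (S1 - S2) by ring.
    apply: le_lt_trans (ler_normcD _ _) _.
    have := ler_normcB (S2 - (nroots (f s') r)%:R) (S1 - (nroots (f s) r)%:R).
    lra.
  move: h4; rewrite -!(rmorph_nat (real_complex R)) -rmorphB normc_real.
  move: (nroots _ _) (nroots _ _) => a b; rewrite ltr_norml => /andP[ab ba].
  by case: (ltngtP a b) => // h; exfalso; move: h; rewrite -(ler_nat R) -natr1; lra.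
(* The segment is cut into K + 1 equal steps, each changing the mean by at most L / (K + 1) <=
   1/2. *)
have [K LK] : exists K : nat, L * 2 <= K.+1%:R.
  exists (Num.truncn (L * 2)); exact: ltW (truncnS_gt _).
have chain j : (j <= K.+1)%N -> nroots (f (j%:R / K.+1%:R)) r = nroots (f 0) r.
  elim: j => [|j IH] jK; first by rewrite mul0r.
  rewrite -IH 1?ltnW//; apply: step.
  - by rewrite divr_ge0//= ler_pdivrMr// mul1r ler_nat.
  - by rewrite divr_ge0//= ler_pdivrMr// mul1r ler_nat ltnW.
  have -> : j.+1%:R / K.+1%:R - j%:R / K.+1%:R = K.+1%:R^-1 :> R.
    by rewrite -mulrBl -[j.+1]add1n natrD addrK mul1r.
  by rewrite ger0_norm ?invr_ge0// ler_pdivrMr ?ltr0n//; lra.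
have := chain _ (leqnn _); rewrite divff// /f scale0r addr0 scale1r => <-.
by rewrite -pE.
Qed.

End Rouche.

(** * Chains to infinity, and zeros minus poles *)

Section RootCounts.
Context {R : realType}.
Local Notation C := R[i].
Implicit Types (x y z k : C) (p q : {poly C}) (r e : R).

Lemma mup_count p z : p != 0 -> mup z p = count_mem z (roots_seq p).
Proof.
move=> p0; have lp : lead_coef p != 0 by rewrite lead_coef_eq0.
rewrite {1}[p]roots_seqE -mul_polyC mupMr ?rootC//.
have: \prod_(a <- roots_seq p) ('X - a%:P) != 0 :> {poly C}.
  by apply: contraNneq p0 => h; rewrite [p]roots_seqE h scaler0.
elim: (roots_seq p) => [|a s IH] /=; first by rewrite big_nil mupNroot ?root1.
rewrite big_cons mulf_eq0 negb_or => /andP[a0 s0].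
by rewrite mupM// IH// -['X - a%:P]expr1 mup_XsubCX; case: eqVneq.
Qed.

Lemma sum_count_mem (T : choiceType) (A : set T) (P : pred T) (s : seq T) :
  (forall a, P a <-> A a) -> (\sum_(a \in A) count_mem a s)%R = count P s.
Proof.
move=> PA; have inA a : (a \in A) = P a by apply/idP/idP => [/set_mem/PA|/PA/mem_set].
rewrite (@fsbigE _ _ _ _ _ [seq a <- undup s | P a]).
- rewrite -(permP (perm_count_undup s)) count_flatten sumnE !big_map big_filter_cond.
  rewrite big_mkcond /=; apply: eq_bigr => a _.
  by rewrite count_nseq inA; case: (P a); rewrite /= ?mul1n ?mul0n.
- by rewrite filter_uniq ?undup_uniq.
- by move=> a /=; rewrite mem_filter => /andP[/PA].
- move=> a /PA Pa; rewrite mem_filter Pa mem_undup /=.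
  by move=> /count_memPn.
Qed.

Lemma zeros_countE (f : {malg C[int]}) r : numerator f != 0 ->
  zeros_count f r = count (fun z => (z != 0) && (normc z < r)%R) (roots_seq (numerator f)).
Proof.
move=> f0; rewrite /zeros_count -(@sum_count_mem _ [set z : C | 0 < `|z| < r%:C]).
  by apply: eq_fsbigr => z _; rewrite mup_count.
by move=> z; rewrite /= normr_gt0 normcE_norm ltcR.
Qed.

Lemma nroots_XnZ k n r : 0 < r -> k != 0 -> nroots (k *: 'X^n) r = n.
Proof.
move=> r0 k0; have p0 : k *: 'X^n != 0 :> {poly C}.
  by rewrite scaler_eq0 negb_or k0 -size_poly_gt0 size_polyXn.
have s0 z : z \in roots_seq (k *: 'X^n) -> z = 0.
  move=> /roots_seq_root /eqP; rewrite hornerZ hornerXn mulf_eq0 (negbTE k0) /=.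
  by rewrite expf_eq0 => /andP[_ /eqP].
rewrite /nroots (@eq_in_count _ _ predT); last first.
  by move=> z /s0 ->; rewrite normc0 r0.
rewrite count_predT; have := congr1 (fun p : {poly C} => size p) (roots_seqE (k *: 'X^n)).
rewrite size_scale// size_polyXn size_scale ?lead_coef_eq0// size_prod_XsubC.
by case.
Qed.

(** Being joined to infinity off K, in a form suited to induction. A step is shorter than the
    distance from its start to K, which is what Rouche's theorem asks for when the constant k' - k
    is added. The explicit margins make this uniform over K without any compactness. *)
Inductive escape (K : set C) : C -> Prop :=
| escape_far k e : 0 < e -> (forall w, K w -> normc w + e <= normc k) -> escape K k
| escape_step k k' e : 0 < e -> (forall w, K w -> normc (k' - k) + e <= normc (k - w)) ->
    escape K k' -> escape K k.

Lemma escape_margin K k : escape K k ->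
  exists2 e, 0 < e & forall w, K w -> e <= normc (k - w).
Proof.
case=> {}k => [e e0 h|k' e e0 h _]; exists e => // w /h; have := lerB_normc k w; first lra.
by have := normc_ge0 (k' - k); lra.
Qed.

(** A chain has finitely many margins, and a displacement by at most half of the smallest keeps
    every step admissible. The condition is one-sided: points of K' need neighbours in K, not
    conversely. *)
Lemma escape_perturb K k : escape K k -> exists2 d, 0 < d &
  forall K' : set C, (forall w', K' w' -> exists2 w, K w & normc (w - w') <= d) -> escape K' k.
Proof.
elim=> {}k => [e e0 h|k' e e0 h _ [d d0 IH]].
  exists (e / 2) => [|K' KK']; first by rewrite divr_gt0.
  apply: (@escape_far _ _ (e / 2)) => [|w' /KK' [w /h hw d]]; first by rewrite divr_gt0.
  by have := lerB_normc w' w; rewrite normcBC; lra.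
exists (Num.min d (e / 2)) => [|K' KK']; first by rewrite lt_min d0 divr_gt0.
apply: (@escape_step _ _ k' (e / 2)) => [|w' /KK' [w /h hw]|]; first by rewrite divr_gt0.
- rewrite le_min => /andP[_ d2]; have := ler_normcD (k - w') (w' - w).
  by rewrite addrA subrK (normcBC w' w); lra.
- apply: IH => w' /KK' [w Kw]; rewrite le_min => /andP[wd _]; by exists w.
Qed.

(** A step of the chain adds (k' - k) x^D to p, a term smaller than p on the circle, so Rouche's
    theorem keeps the count. At the far end k dominates K, and p is compared with k x^D, whose D
    roots are all at 0. *)
Lemma escape_nroots K k p D r : 0 < r -> escape K k ->
  (forall x, normc x = r -> exists2 w, K w & p.[x] = x ^+ D * (k - w)) -> nroots p r = D.
Proof.
move=> r0 esc; elim: esc p => {}k => [e e0 h|k' e e0 h _ IH] p pE.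
- have nr : normc (r%:C : C) = r by rewrite normc_real gtr0_norm.
  have k0 : k != 0.
    have [w /h + _] := pE _ nr; rewrite -normc_gt0; have := normc_ge0 w; lra.
  rewrite -[RHS](@nroots_XnZ k D r)//; apply: (@rouche _ _ _ r (r ^+ D * e)) => //.
    by rewrite mulr_gt0// exprn_gt0.
  move=> x nx; have [w /h hw ->] := pE _ nx.
  rewrite hornerZ hornerXn mulrBr [k * _]mulrC addrAC subrr add0r normcN !normcM normcX nx.
  by rewrite -mulrDr ler_pM2l// exprn_gt0.
- have pE' x : normc x = r ->
      exists2 w, K w & (p + (k' - k) *: 'X^D).[x] = x ^+ D * (k' - w).
    move=> /pE [w Kw px]; exists w => //.
    by rewrite hornerD px hornerZ hornerXn; ring.
  rewrite -(IH _ pE'); apply/esym/(@rouche _ _ _ r (r ^+ D * e)) => //.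
    by rewrite mulr_gt0// exprn_gt0.
  move=> x nx; have [w /h hw px] := pE _ nx.
  rewrite hornerD hornerZ hornerXn addrAC subrr add0r px !normcM normcX nx mulrC.
  by rewrite -mulrDr ler_pM2l// exprn_gt0.
Qed.

Lemma pole_order_attained (f : {malg C[int]}) : (0 < pole_order f)%N ->
  exists2 e, e \in msupp f & e = - (pole_order f)%:Z.
Proof.
rewrite /pole_order.
suff [->//|[e es [e0 <-]] _] : (\max_(e <- msupp f | (e < 0)%R) absz e)%N = 0%N \/
   exists2 e, e \in msupp f & (e < 0)%R /\ absz e = (\max_(e <- msupp f | (e < 0)%R) absz e)%N.
  by exists e => //; rewrite ltz0_abs// opprK.
rewrite big_seq_cond; elim/big_ind: _ => [|a b ha hb|e /andP[es e0]].
- by left.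
- by rewrite /maxn; case: ifP.
- by right; exists e.
Qed.

Lemma pole_order_ge (f : {malg C[int]}) (e : int) : e \in msupp f -> 0 <= e + (pole_order f)%:Z.
Proof.
move=> es; have [e0|e0] := leP 0 e; first by rewrite addr_ge0.
rewrite -[e]opprK -(ltz0_abs e0) addrC subr_ge0 lez_nat /pole_order.
exact: leq_bigmax_seq.
Qed.

Lemma numerator_horner (f : {malg C[int]}) x : x != 0 ->
  (numerator f).[x] = x ^+ pole_order f * mmap idfun (fun m => x ^ m) f.
Proof.
move=> x0; rewrite mmapE mulr_sumr horner_sum; apply: eq_big_seq => e es.
rewrite hornerZ hornerXn mulrCA; congr (_ * _).
have xu : x \is a GRing.unit by rewrite unitfE.
by rewrite !exprnP gez0_abs ?pole_order_ge// -expfzDr// addrC.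
Qed.

(** The most negative exponent, and no other, is shifted to the constant term. *)
Lemma numerator_coef0 (f : {malg C[int]}) : (0 < pole_order f)%N -> (numerator f).[0] != 0.
Proof.
move=> p0; have [e es eE] := pole_order_attained p0.
rewrite horner_sum (big_rem e)//= hornerZ hornerXn eE addNr expr0 mulr1 big1_seq ?addr0.
  by rewrite -eE mcoeff_neq0.
move=> i /andP[_]; rewrite mem_rem_uniq ?fset_uniq// inE => /andP[ie is_].
by rewrite hornerZ hornerXn expr0n absz_eq0 addr_eq0 (negbTE ie) mulr0.
Qed.

(** By [escape_nroots] the numerator has as many roots in the disc as the order of the pole. This
    count includes 0 and [zeros_count] does not, but they agree: if there is a pole, 0 is not a
    root; if there is none, the disc contains no root at all. *)
Lemma escape_zeros_minus_poles K k (f : {malg C[int]}) r : 0 < r -> escape K k ->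
  (forall x, normc x = r -> exists2 w, K w & mmap idfun (fun m => x ^ m) f = k - w) ->
  zeros_minus_poles f r = 0.
Proof.
move=> r0 esc fE; have nf : nroots (numerator f) r = pole_order f.
  apply: (escape_nroots r0 esc) => x nx; have [w Kw fx] := fE _ nx.
  by exists w => //; rewrite numerator_horner ?fx// -normc_gt0 nx.
(* Were the numerator zero, evaluation at x = r would put k into K, against the margin. *)
have f0 : numerator f != 0.
  have nr : normc (r%:C : C) = r by rewrite normc_real gtr0_norm.
  have r1 : (r%:C : C) != 0 by rewrite -normc_gt0 nr.
  apply/eqP => h; have := numerator_horner f r1; rewrite h horner0.
  have [w Kw ->] := fE _ nr => /esym/eqP; rewrite mulf_eq0 expf_eq0 (negbTE r1) andbF /=.
  have [e e0 /(_ _ Kw)] := escape_margin esc.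
  by move=> + /eqP kw; rewrite kw normc0 leNgt e0.
apply/eqP; rewrite /zeros_minus_poles subr_eq0 eqz_nat zeros_countE// -nf.
have [p0|p0] := posnP (pole_order f).
  rewrite nf p0 -leqn0 -[X in (_ <= X)%N]p0 -nf; apply: sub_count => z.
  by case/andP.
apply/eqP/eq_in_count => z zs; case: eqVneq => //= z0; exfalso.
by have := roots_seq_root zs; rewrite z0; apply/eqP/numerator_coef0.
Qed.

End RootCounts.

(** * Logarithmic means over two circles *)

Lemma eq_count_sub (T : eqType) (s : seq T) (P Q : pred T) : subpred P Q ->
  count P s = count Q s -> {in s, P =1 Q}.
Proof.
move=> PQ; elim: s => [//|a s IH] /= PQs.
have le_ : (count P s <= count Q s)%N by exact: sub_count.
have laQ : (P a <= Q a)%N by case Pa : (P a); rewrite // (PQ _ Pa).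
have [ea es] : (P a : nat) = Q a /\ count P s = count Q s by lia.
move=> z; rewrite inE => /predU1P[->|]; last exact: IH.
by move: ea; case: (P a); case: (Q a).
Qed.

Section LogMeans.
Context {R : realType}.
Local Notation C := R[i].
Implicit Types (u z : C) (p : {poly C}) (r e d y : R).

(** Both bounds come from ln x <= x - 1, at x = y and at x = 1 / y; d <= 1/2 keeps 1 / y at most
    2. *)
Lemma ln_near1 y d : d <= 1 / 2 -> `|y - 1| <= d -> `|ln y| <= 2 * d.
Proof.
move=> d2; rewrite ler_norml => /andP[h1 h2].
have y0 : 0 < y by lra.
have hu : ln y <= y - 1.
  by have := @le_ln1Dx R (y - 1); rewrite addrCA subrr addr0; apply; lra.
have hl : - ln y <= y^-1 - 1.
  rewrite -lnV ?posrE//.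
  have := @le_ln1Dx R (y^-1 - 1); rewrite addrCA subrr addr0; apply.
  have : 0 < y^-1 by rewrite invr_gt0.
  lra.
have : y^-1 - 1 <= 2 * d.
  rewrite lerBlDr -[y^-1]mul1r ler_pdivrMr//; nra.
by rewrite ler_norml => h3; apply/andP; split; lra.
Qed.

Lemma ln_normc_1B q e : 0 <= q < 1 -> 0 < e -> exists n0, forall n, (n0 <= n)%N ->
  forall u, normc u <= q -> 0 < normc (1 - u ^+ n) /\ `|ln (normc (1 - u ^+ n))| <= e.
Proof.
move=> q01 e0; pose d := Num.min (1 / 2) (e / 2).
have d0 : 0 < d by rewrite /d lt_min; apply/andP; split; lra.
have [d1 d2] : d <= 1 / 2 /\ d <= e / 2 by rewrite /d !ge_min !lexx orbT.
have [n0 H] := expr_small q01 d0; exists n0 => n /H h u uq.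
have ud : normc (u ^+ n) <= d.
  apply: le_trans h; rewrite normcX lerXn2r ?nnegrE ?normc_ge0//.
  by case/andP: q01.
have := @ln_near1 (normc (1 - u ^+ n)) d d1.
suff h2 : `|normc (1 - u ^+ n) - 1| <= d.
  by move=> /(_ h2) ?; move: h2; rewrite ler_norml => /andP[? _]; split; lra.
have := ler_normcB 1 (u ^+ n); have := lerB_normc 1 (u ^+ n).
by rewrite normc1 ler_norml => *; apply/andP; split; lra.
Qed.

(** log |z^n - r^n| is close to n log max(|z|, r), and likewise with 1 for r. The difference is n
    log r for z inside both circles and 0 for z outside both; in the annulus, which is excluded, it
    would depend on |z|. The error tends to 0 even without division by n. *)
Lemma ln_pow_ratio z r e : 1 < r -> normc z != 1 -> normc z != r ->
  (normc z < 1) = (normc z < r) -> 0 < e -> exists n0, forall n, (n0 <= n)%N ->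
  `|ln (normc (z ^+ n - r%:C ^+ n)) - ln (normc (z ^+ n - 1)) -
    n%:R * ((normc z < 1)%R%:R * ln r)| <= e.
Proof.
move=> r1 z1 zr zz e0; have r0 : 0 < r by lra.
have e2 : 0 < e / 2 by lra.
have rC0 : r%:C != 0 :> C by rewrite -normc_gt0 normc_real gtr0_norm.
have [zlt|zge] := ltP (normc z) 1.
- have q01 : 0 <= normc z < 1 by rewrite normc_ge0.
  have [n0 H] := ln_normc_1B q01 e2; exists n0 => n /H h.
  have [_ ha] := h z (lexx _).
  have [|nz1 hb] := h (z / r%:C).
    rewrite normcf_div normc_real gtr0_norm// ler_pdivrMr// ler_peMr ?normc_ge0//.
    exact: ltW.
  rewrite (_ : z ^+ n - r%:C ^+ n = - (r%:C ^+ n * (1 - (z / r%:C) ^+ n))); last first.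
    by rewrite mulrBr mulr1 expr_div_n mulrCA divff ?expf_neq0// mulr1 opprB.
  rewrite normcN normcM normcX normc_real (gtr0_norm r0).
  rewrite lnM ?posrE ?exprn_gt0// lnXn// mul1r mulr_natl (normcBC _ 1).
  move: ha hb; rewrite !ler_norml => /andP[? ?] /andP[? ?]; apply/andP; split; lra.
- have z0 : z != 0 by rewrite -normc_gt0; lra.
  have zr' : r < normc z.
    by rewrite lt_neqAle eq_sym zr leNgt -zz -leNgt.
  have zn0 : 0 < normc z by lra.
  have q01 : 0 <= r / normc z < 1 by rewrite divr_ge0 ?(ltW r0) ?(ltW zn0)//= ltr_pdivrMr// mul1r.
  have [n0 H] := ln_normc_1B q01 e2; exists n0 => n /H h.
  have [|nz1 ha] := h (r%:C / z); first by rewrite normcf_div normc_real gtr0_norm.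
  have [|nz2 hb] := h (1 / z).
    by rewrite normcf_div normc1 ler_pM2r ?invr_gt0// ltW.
  have fac (w : C) : z ^+ n - w ^+ n = z ^+ n * (1 - (w / z) ^+ n).
    by rewrite mulrBr mulr1 expr_div_n mulrCA divff ?expf_neq0// mulr1.
  rewrite fac -[X in z ^+ n - X](expr1n _ n) fac !normcM.
  rewrite !lnM ?posrE// ?normcX ?exprn_gt0// mul0r mulr0 subr0.
  move: ha hb; rewrite !ler_norml => /andP[? ?] /andP[? ?]; apply/andP; split; lra.
Qed.

(** A discrete Jensen formula: for each root z the product of its distances to the n sample points
    is |z^n - r^n|. *)
Lemma sum_ln_prim_root p r n : 0 < r -> (0 < n)%N -> (forall x, normc x = r -> p.[x] != 0) ->
  \sum_(i < n) ln (normc p.[r%:C * unity_gen n ^+ i]) =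
  n%:R * ln (normc (lead_coef p)) + \sum_(z <- roots_seq p) ln (normc (z ^+ n - r%:C ^+ n)).
Proof.
move=> r0 n0 pr.
have nx (i : 'I_n) : normc (r%:C * unity_gen n ^+ i : C) = r.
  by rewrite normcM normc_unity_gen mulr1 normc_real gtr0_norm.
have lp : 0 < normc (lead_coef p).
  rewrite normc_gt0 lead_coef_eq0; apply: contraNneq (pr _ (nx (Ordinal n0))) => ->.
  by rewrite horner0.
have pos (i : 'I_n) z : z \in roots_seq p -> 0 < normc (z - r%:C * unity_gen n ^+ i).
  move=> zs; rewrite normc_gt0 subr_eq0; apply: contraNneq (pr _ (nx i)) => <-.
  by rewrite roots_seq_root.
have lnprod (I : eqType) (s : seq I) (F : I -> R) : (forall i, i \in s -> 0 < F i) ->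
    ln (\prod_(i <- s) F i) = \sum_(i <- s) ln (F i).
  elim: s => [|i s IH] F0; first by rewrite !big_nil ln1.
  rewrite !big_cons lnM ?IH// ?posrE ?F0 ?inE ?eqxx//; last first.
    rewrite big_seq prodr_gt0// => j js; by rewrite F0// inE js orbT.
  by move=> j js; rewrite F0// inE js orbT.
transitivity (\sum_(i < n) (ln (normc (lead_coef p)) +
    \sum_(z <- roots_seq p) ln (normc (z - r%:C * unity_gen n ^+ i)))).
  apply: eq_bigr => i _; rewrite {1}[p]roots_seqE hornerZ horner_prod_seq normcM normc_prod.
  under eq_bigr do rewrite normcBC.
  rewrite lnM ?posrE//; last by rewrite big_seq prodr_gt0// => z; exact: pos.
  by rewrite lnprod// => z; exact: pos.
rewrite big_split /= sumr_const card_ord mulr_natl; congr (_ + _).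
rewrite exchange_big /=; apply: eq_big_seq => z zs.
rewrite -(prod_prim_root _ _ (unity_gen_prim n0)) normc_prod lnprod// => i _.
exact: pos.
Qed.

(* As both discs contain D roots, the annulus between the circles contains none. *)
Lemma mean_ln_annulus p D r e : 1 < r -> nroots p 1 = D -> nroots p r = D ->
  (forall x, normc x = 1 -> p.[x] != 0) -> (forall x, normc x = r -> p.[x] != 0) ->
  0 < e -> exists n0, forall n, (n0 <= n)%N -> (0 < n)%N ->
  `|\sum_(i < n) (ln (normc p.[r%:C * unity_gen n ^+ i]) - D%:R * ln r) -
    \sum_(i < n) ln (normc p.[unity_gen n ^+ i])| <= e.
Proof.
move=> r1 p1D prD p1 pr e0; have r0 : 0 < r by lra.
pose s := roots_seq p.
have s1 z : z \in s -> normc z != 1.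
  by move=> zs; apply/negP => /eqP /p1; rewrite roots_seq_root ?eqxx.
have sr z : z \in s -> normc z != r.
  by move=> zs; apply/negP => /eqP /pr; rewrite roots_seq_root ?eqxx.
have s1r z : z \in s -> (normc z < 1) = (normc z < r).
  apply: (@eq_count_sub _ s (fun z => normc z < 1)%R (fun z => normc z < r)%R).
    by move=> w w1; lra.
  by move: p1D prD; rewrite /nroots => -> ->.
have key t : {subset t <= s} -> forall d, 0 < d -> exists n0, forall n, (n0 <= n)%N ->
    `|\sum_(z <- t) ln (normc (z ^+ n - r%:C ^+ n)) - \sum_(z <- t) ln (normc (z ^+ n - 1)) -
      n%:R * ((count (fun z => normc z < 1)%R t)%:R * ln r)| <= d.
  elim: t => [|a t IH] ts d d0.
    exists 0%N => n _; rewrite !big_nil /= !(mul0r, mulr0, subr0) normr0; exact: ltW.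
  have d2 : 0 < d / 2 by lra.
  have [z zt|n1 H1] := IH _ _ d2; first by apply: ts; rewrite inE zt orbT.
  have as_ : a \in s by apply: ts; rewrite inE eqxx.
  have [n2 H2] := ln_pow_ratio r1 (s1 _ as_) (sr _ as_) (s1r _ as_) d2.
  exists (maxn n1 n2) => n; rewrite geq_max => /andP[/H1 h1 /H2 h2].
  rewrite !big_cons /= natrD mulrDl mulrDr.
  move: h1 h2; rewrite !ler_norml => /andP[? ?] /andP[? ?]; apply/andP; split; lra.
have [n0 H] := key s (fun _ => id) e e0; exists n0 => n /H h n_gt0.
have := sum_ln_prim_root (@ltr01 R) n_gt0 p1.
rewrite rmorph1 expr1n; under eq_bigr do rewrite mul1r; move=> ->.
rewrite sumrB (sum_ln_prim_root r0 n_gt0 pr) sumr_const card_ord -mulr_natl.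
move: h; rewrite -/s; have -> : count (fun z => normc z < 1)%R s = D by [].
rewrite !ler_norml => /andP[? ?]; apply/andP; split; lra.
Qed.

End LogMeans.

(** * The image of a torus *)

Section Topology.
Context {R : realType}.
Local Notation C := R[i].

(** Balls of [C^o] have complex radii, and positivity makes these real. *)
Lemma nbhs_normcP (x : C^o) (A : set C^o) :
  nbhs x A <-> exists2 e : R, 0 < e & forall y, normc (x - y) < e -> A y.
Proof.
split=> [/nbhs_ballP[e /= e0 xA]|[e e0 xA]].
  move: e0 xA; case: e => a b; rewrite ltcE /= => /andP[/eqP -> a0] xA.
  exists a => // y xy; apply: xA; rewrite -ball_normE /= normcE_norm.
  by rewrite ltcR.
apply/nbhs_ballP; exists e%:C => /=; first by rewrite ltcR.
by move=> y; rewrite -ball_normE /= normcE_norm ltcR; exact: xA.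
Qed.

Lemma continuous_ReIm (T : topologicalType) (f : T -> C^o) :
  continuous (fun t => complex.Re (f t)) -> continuous (fun t => complex.Im (f t)) ->
  continuous f.
Proof.
move=> cr ci t A /nbhs_normcP [e e0 xA].
have e2 : 0 < e / 2 by rewrite divr_gt0.
have /cvgrPdist_lt /(_ _ e2) h1 := cr t.
have /cvgrPdist_lt /(_ _ e2) h2 := ci t.
rewrite /= nbhs_filterE /fmap /=; near=> s; apply: xA.
apply: le_lt_trans (ler_normc_ReIm _) _; rewrite !raddfB [e]splitr ltrD//.
  by near: s.
by near: s.
Unshelve. all: by end_near. Qed.

Lemma continuous_sumr (T : topologicalType) (I : Type) (s : seq I) (f : I -> T -> R) :
  (forall i, continuous (f i)) -> continuous (fun t => \sum_(i <- s) f i t).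
Proof.
move=> cf; elim: s => [|i s IH] t.
  by under eq_fun do rewrite big_nil; exact: cvg_cst.
under eq_fun do rewrite big_cons.
by apply: cvgD; [exact: cf|exact: IH].
Qed.

(** Off K, escaping is locally constant, since close points are joined by one step in either
    direction. Within the component S the escaping points are therefore open and closed; an
    unbounded S contains points far beyond B, so they exist and fill S. *)
Lemma unbounded_component_escape (K : set C^o) (B : R) k : closed K ->
  (forall w, K w -> normc w <= B) -> unbounded_component K k -> escape K k.
Proof.
move=> clK KB [nKk ub]; set S := connected_component (~` K) k in ub.
have sub z : S z -> ~ K z by exact: connected_component_sub.
have far z : B + 1 <= normc z -> escape K z.
  by move=> zB; apply: (@escape_far _ _ _ 1) => // w /KB; lra.
have opK z : ~ K z -> exists2 e : R, 0 < e & forall y, normc (z - y) < e -> ~ K y.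
  move=> nKz; apply/nbhs_normcP; apply: open_nbhs_nbhs; split => //.
  exact: closed_openC.
have local z : ~ K z -> exists2 e : R, 0 < e & forall y, normc (z - y) < e ->
    (escape K z <-> escape K y).
  (* K keeps distance e from z, hence more than 2e/3 from any y within e/3 of z: the step has margin
     e/3 both ways. *)
  move=> /opK [e e0 he]; exists (e / 3); first by rewrite divr_gt0.
  have hw w : K w -> e <= normc (z - w).
    by move=> Kw; rewrite leNgt; apply/negP => /he.
  move=> y zy; split=> h.
    apply: (@escape_step _ _ _ z (e / 3)); rewrite ?divr_gt0// => w /hw.
    have := ler_normcD (z - y) (y - w); rewrite addrA subrK; lra.
  apply: (@escape_step _ _ _ y (e / 3)); rewrite ?divr_gt0// => w /hw.
  rewrite normcBC; lra.
have cS : connected S by exact: component_connected.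
have Sk : S k by exact: connected_component_refl.
suff : S `&` [set z | escape K z] = S by move=> /seteqP [_ /(_ _ Sk)] [].
have [z Sz zB] : exists2 z, S z & B + 1 <= normc z.
  apply: contrapT => nz; apply: ub; exists (B + 1)%:C; split.
    by apply/complex_realP; exists (B + 1).
  move=> x Bx z Sz /=; apply: ltW; apply: le_lt_trans Bx; rewrite normcE_norm lecR.
  by rewrite leNgt; apply/negP => /ltW h; apply: nz; exists z.
apply: cS.
- by exists z; split => //; exact: far.
- exists [set z | ~ K z /\ escape K z]; last first.
    by apply/seteqP; split => y [Sy]; [move=> h; split => //; split => //; exact: sub|case].
  rewrite openE => y [Ky ey]; apply/nbhs_normcP.
  have [e e0 he] := opK _ Ky; have [d d0 hd] := local _ Ky.
  exists (Num.min d e); first by rewrite lt_min d0.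
  move=> x; rewrite lt_min => /andP[/hd xd /he xe]; split => //; exact/xd.
- exists (~` [set z | ~ K z /\ ~ escape K z]); last first.
    apply/seteqP; split => y [Sy h]; split => //; first by case.
    by apply: contrapT => ney; apply: h; split => //; exact: sub.
  apply: open_closedC; rewrite openE => y [Ky ey]; apply/nbhs_normcP.
  have [e e0 he] := opK _ Ky; have [d d0 hd] := local _ Ky.
  exists (Num.min d e); first by rewrite lt_min d0.
  by move=> x; rewrite lt_min => /andP[/hd xd /he xe]; split => // /xd.
Qed.

End Topology.

(** * Laurent polynomials in logarithmic polar coordinates *)

Section TorusValues.
Context {R : realType} {n : nat}.
Local Notation C := R[i].
Implicit Types (P : laurent R n) (u v t : 'I_n -> R) (m : {ffun 'I_n -> int}).

Definition pairing m u : R := \sum_j (m j)%:~R * u j.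

Lemma pairingD m u v : pairing m (u \+ v) = pairing m u + pairing m v.
Proof. by rewrite -big_split; apply: eq_bigr => j _; rewrite mulrDr. Qed.

Definition polar_eval P u t : C :=
  \sum_(m <- msupp P) P@_m * polar (pairing m u) (pairing m t).

Lemma laurent_eval_polar P u t :
  laurent_eval P (fun j => polar (u j) (t j)) = polar_eval P u t.
Proof.
apply: eq_bigr => m _; congr (_ * _).
by rewrite (eq_bigr _ (fun j _ => polar_exprz _ _ _)) polar_prod.
Qed.

Lemma laurent_evalE P (x : 'I_n -> C) :
  laurent_eval P x = mmap idfun (fun m : {ffun 'I_n -> int} => \prod_j x j ^ m j) P.
Proof. by rewrite mmapE. Qed.

Lemma laurent_eval_pencil P k (x : 'I_n -> C) :
  laurent_eval (pencil P k) x = k - laurent_eval P x.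
Proof.
rewrite !laurent_evalE mmapB mmapU /=; congr (_ - _).
by rewrite big1 ?mulr1// => j _; rewrite ffunE expr0z.
Qed.

Lemma torus_polar (a : 'I_n -> R) (x : 'I_n -> C) : (forall j, 0 < a j) -> torus a x ->
  exists2 t, (forall j, 0 <= t j <= 2 * pi) & x = (fun j => polar (ln (a j)) (t j)).
Proof.
move=> a0 xa; have /choice [t ht] : forall j, exists t : R, 0 <= t <= 2 * pi /\
    x j = polar (ln (a j)) t.
  move=> j; apply: polar_surj; rewrite lnK ?posrE//.
  by have /eqP := xa j; rewrite normcE_norm (inj_eq (@complexI _)) => /eqP.
by exists t => [j|]; [case: (ht j)|apply/funext => j; case: (ht j)].
Qed.

Lemma polar_torus (a : 'I_n -> R) t : (forall j, 0 < a j) ->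
  torus a (fun j => polar (ln (a j)) (t j)).
Proof. by move=> a0 j; rewrite normcE_norm normc_polar lnK ?posrE. Qed.

Lemma torus_imageE P (a : 'I_n -> R) : (forall j, 0 < a j) ->
  torus_image P a = polar_eval P (fun j => ln (a j)) @` [set t | forall j, 0 <= t j <= 2 * pi].
Proof.
move=> a0; apply/seteqP; split => w [].
  by move=> x /(torus_polar a0) [t t01 ->] <-; exists t => //; rewrite laurent_eval_polar.
move=> t _ <-; exists (fun j => polar (ln (a j)) (t j)); first exact: polar_torus.
by rewrite laurent_eval_polar.
Qed.

Lemma torus_image_polar_eval P (a : 'I_n -> R) t : (forall j, 0 < a j) ->
  torus_image P a (polar_eval P (fun j => ln (a j)) t).
Proof.
move=> a0; exists (fun j => polar (ln (a j)) (t j)); first exact: polar_torus.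
by rewrite laurent_eval_polar.
Qed.

Lemma Re_polar_eval P u t : complex.Re (polar_eval P u t) =
  \sum_(m <- msupp P) expR (pairing m u) *
    (complex.Re P@_m * cos (pairing m t) - complex.Im P@_m * sin (pairing m t)).
Proof.
rewrite raddf_sum; apply: eq_bigr => m _; case: (P@_m) => a b /=.
by rewrite /polar /= !mul0r subr0 addr0; ring.
Qed.

Lemma Im_polar_eval P u t : complex.Im (polar_eval P u t) =
  \sum_(m <- msupp P) expR (pairing m u) *
    (complex.Re P@_m * sin (pairing m t) + complex.Im P@_m * cos (pairing m t)).
Proof.
rewrite raddf_sum; apply: eq_bigr => m _; case: (P@_m) => a b /=.
by rewrite /polar /= !mul0r subr0 addr0; ring.
Qed.

Lemma normc_polar_eval_le P u t :
  normc (polar_eval P u t) <= \sum_(m <- msupp P) normc P@_m * expR (pairing m u).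
Proof.
apply: le_trans (ler_normc_sum _ _ _) _.
by apply: ler_sum => m _; rewrite normcM normc_polar.
Qed.

Lemma polar_eval_continuous (T : topologicalType) P u (f : 'I_n -> T -> R) :
  (forall j, continuous (f j)) ->
  continuous (fun s => polar_eval P u (fun j => f j s) : C^o).
Proof.
move=> cf.
have cM (c : R) (g : T -> R) : continuous g -> continuous (fun s => c * g s).
  by move=> cg t; apply: cvgMl_tmp; exact: cg.
have cp m : continuous (fun s => pairing m (fun j => f j s)).
  by apply: continuous_sumr => j; exact: cM.
have cc m : continuous (fun s => cos (pairing m (fun j => f j s))).
  move=> t; apply: (continuous_comp (cp m t)); exact: continuous_cos.
have cs m : continuous (fun s => sin (pairing m (fun j => f j s))).
  move=> t; apply: (continuous_comp (cp m t)); exact: continuous_sin.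
apply: continuous_ReIm.
  under eq_fun do rewrite Re_polar_eval.
  apply: continuous_sumr => m; apply: (cM) => s.
  by apply: cvgB; [exact: (cM _ _ (cc m))|exact: (cM _ _ (cs m))].
under eq_fun do rewrite Im_polar_eval.
apply: continuous_sumr => m; apply: (cM) => s.
by apply: cvgD; [exact: (cM _ _ (cs m))|exact: (cM _ _ (cc m))].
Qed.

(** Compactness is taken from the angles: a product of segments is compact by Tychonoff's
    theorem. *)
Lemma closed_torus_image P (a : 'I_n -> R) : (forall j, 0 < a j) ->
  closed (torus_image P a : set C^o).
Proof.
move=> a0; rewrite torus_imageE//; apply: compact_closed; first exact: norm_hausdorff.
have cK := @tychonoff 'I_n (fun=> R) (fun=> [set x : R | 0 <= x <= 2 * pi])
  (fun=> @segment_compact R 0 (2 * pi)).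
have cf := @polar_eval_continuous
  (ArrowAsProduct.prod__canonical__topology_structure_Topological (fun _ : 'I_n => R))
  P (fun j => ln (a j)) (@proj 'I_n (fun=> R)) (@proj_continuous 'I_n (fun=> R)).
exact: (continuous_compact (continuous_subspaceT cf) cK).
Qed.

(** [escape_perturb] serves here at distance 0, to exchange the image of the torus for the range of
    [polar_eval] over unrestricted angles. *)
Lemma torus_escape P (a : 'I_n -> R) k : (forall j, 0 < a j) ->
  unbounded_component (torus_image P a) k ->
  escape (range (polar_eval P (fun j => ln (a j)))) k.
Proof.
move=> a0 ubk; suff [d d0 H] : exists2 d, 0 < d & forall K' : set C,
    (forall w', K' w' -> exists2 w, torus_image P a w & normc (w - w') <= d) -> escape K' k.
  apply: H => w [t _ <-]; exists (polar_eval P (fun j => ln (a j)) t).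
    exact: torus_image_polar_eval.
  by rewrite subrr normc0 ltW.
apply: escape_perturb; apply: unbounded_component_escape ubk; first exact: closed_torus_image.
by move=> w; rewrite torus_imageE// => -[t _ <-]; exact: normc_polar_eval_le.
Qed.

(** The bound is uniform in t because t only rotates each monomial, while v multiplies its modulus
    by the exponential of a small pairing. *)
Lemma polar_eval_perturb P u e : 0 < e -> exists2 d, 0 < d &
  forall v, (forall j, `|v j| <= d) ->
  forall t, normc (polar_eval P (u \+ v) t - polar_eval P u t) <= e.
Proof.
move=> e0; pose M := \sum_(m <- msupp P) normc P@_m * expR (pairing m u).
have M0 : 0 <= M by rewrite sumr_ge0// => m _; rewrite mulr_ge0 ?normc_ge0 ?expR_ge0.
(* M is the total modulus of the terms, and T below bounds the size of every exponent vector in the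
   support; adding 1 to each avoids a division by zero. *)
have [s s0 hs] : exists2 s : R, 0 < s & forall x, `|x| <= s -> `|expR x - 1| <= e / (1 + M).
  have eM : 0 < e / (1 + M) by rewrite divr_gt0// ltr_wpDr.
  have /cvgrPdist_le /(_ _ eM) /nbhs_ballP [s /= s0 hs] := @continuous_expR R 0.
  exists (s / 2) => [|x xs]; first by rewrite divr_gt0.
  rewrite distrC -[X in `|X - _|]expR0; apply: hs; rewrite /ball /= sub0r normrN.
  by apply: le_lt_trans xs _; lra.
pose T := \sum_(m <- msupp P) \sum_j `|m j|%:~R : R.
have T0 : 0 <= T.
  by apply: sumr_ge0 => m _; apply: sumr_ge0 => j _; rewrite ler0z.
exists (s / (1 + T)) => [|v hv t]; first by rewrite divr_gt0// ltr_wpDr.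
rewrite -sumrB; apply: le_trans (ler_normc_sum _ _ _) _.
apply: (@le_trans _ _ (\sum_(m <- msupp P) normc P@_m * expR (pairing m u) * (e / (1 + M)))).
  rewrite big_seq [leRHS]big_seq; apply: ler_sum => m mP.
  rewrite pairingD -[X in polar (_ + _) X]addr0 polarD -mulrBr.
  rewrite -[X in _ * _ - X]mulr1 -mulrBr.
  rewrite normcM [X in _ * X]normcM normc_polar -!mulrA ler_wpM2l ?normc_ge0// ler_wpM2l ?expR_ge0//.
  rewrite /polar cos0 sin0 mulr1 -(rmorph1 (real_complex R)) -rmorphB normc_real.
  apply: hs; apply: le_trans (ler_norm_sum _ _ _) _.
  apply: (@le_trans _ _ ((\sum_j `|m j|%:~R) * (s / (1 + T)))).
    rewrite mulr_suml; apply: ler_sum => j _; rewrite normrM intr_norm.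
    by rewrite ler_wpM2l.
  rewrite mulrA ler_pdivrMr ?ltr_wpDr// mulrC ler_pM2l// ler_wpDl//.
  rewrite /T (big_rem m)//= lerDl sumr_ge0// => i _; apply: sumr_ge0 => j _.
  by rewrite ler0z.
rewrite -mulr_suml -/M mulrA ler_pdivrMr ?ltr_wpDr// mulrC ler_pM2l//.
by rewrite lerDr.
Qed.

End TorusValues.

(** * Translation invariance of the torus integral *)

Section TorusIntegral.
Context {R : realType}.
Local Notation MR := (measurableTypeR R).
Local Notation mu := (@lebesgue_measure R).
Local Open Scope ereal_scope.
Local Notation twopi := (2 * pi : R)%R.

Lemma measurable_shift (c : R) : measurable_fun [set: MR] (fun x : MR => (x + c)%R : MR).
Proof.
apply: (@measurable_funD _ MR R setT id (cst c)); [exact: measurable_id|exact: measurable_cst].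
Qed.

(** Lebesgue measure is determined by its values on half-open intervals, whose lengths the shift
    preserves. *)
Lemma lebesgue_measure_shift (c : R) (A : set MR) : measurable A ->
  mu ((fun x : MR => (x + c)%R : MR) @^-1` A) = mu A.
Proof.
move=> mA; apply/esym.
apply: (@lebesgue_measure_unique _
  (measure_function_pushforward__canonical__measure_function_Measure mu (measurable_shift c))) => //.
move=> _ [[a b] _ <-] /=; rewrite /pushforward.
have -> : (fun x : MR => (x + c)%R : MR) @^-1` `]a, b]%classic = `]a - c, b - c]%classic%R.
  by apply/seteqP; split => x /=; rewrite !in_itv /= lerBrDr ltrBlDr.
rewrite !lebesgue_measure_itv /= !lte_fin ltrD2r.
by case: ifP => // _; rewrite -!EFinB; congr EFin; ring.
Qed.

Lemma ge0_integral_shift (f : MR -> \bar R) (c : R) : measurable_fun [set: MR] f ->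
  (forall x, 0 <= f x) -> \int[mu]_x f (x + c)%R = \int[mu]_x f x.
Proof.
move=> mf f0.
have -> : \int[mu]_x f x = \int[pushforward mu (fun x : MR => (x + c)%R : MR)]_x f x.
  apply: (@eq_measure_integral _ _ _ _
   (measure_function_pushforward__canonical__measure_function_Measure mu (measurable_shift c))).
  by move=> A mA _; exact: esym (lebesgue_measure_shift c mA).
rewrite (ge0_integral_pushforward (measurable_shift c))//.
Qed.

Lemma ge0_integral_itv_shift (f : MR -> \bar R) (a b c : R) : measurable_fun [set: MR] f ->
  (forall x, 0 <= f x) ->
  \int[mu]_(x in `[a, b[) f (x + c)%R = \int[mu]_(x in `[(a + c)%R, (b + c)%R[) f x.
Proof.
move=> mf f0; rewrite integral_mkcond [RHS]integral_mkcond -[RHS](@ge0_integral_shift _ c).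
- apply: eq_integral => x _; rewrite !patchE.
  by rewrite !mem_setE !in_itv /= lerD2r ltrD2r.
- by apply: (measurable_restrictT _ (measurable_itv _)).1; exact: measurable_funTS.
- by move=> x; rewrite patchE; case: ifP.
Qed.

(** The shift is reduced modulo the period to d in [0, 2 pi). The interval [d, 2 pi + d) is then cut
    at 2 pi, and the overhang is moved back by one period. *)
Lemma ge0_integral_period_shift (f : MR -> \bar R) (c : R) : measurable_fun [set: MR] f ->
  (forall x, 0 <= f x) -> (forall x (m : int), f (x + twopi * m%:~R)%R = f x) ->
  \int[mu]_(x in `[0%R, twopi]) f (x + c)%R = \int[mu]_(x in `[0%R, twopi]) f x.
Proof.
move=> mf f0 fp; have pi0 : (0 < twopi)%R by rewrite mulr_gt0 ?pi_gt0.
pose m := Num.floor (c / twopi); pose d := (c - twopi * m%:~R)%R.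
have [d0 d1] : (0 <= d /\ d < twopi)%R.
  have /andP[] := Num.Theory.floor_itv (c / twopi).
  rewrite -/m ler_pdivlMr// ltr_pdivrMr// intrD mulrDl mul1r.
  by rewrite /d [(twopi * _)%R]mulrC => *; split; lra.
transitivity (\int[mu]_(x in `[0%R, twopi]) f (x + d)%R).
  by apply: eq_integral => x _; rewrite -[RHS](fp _ m) -addrA subrK.
have mfd : measurable_fun [set: MR] (fun x => f (x + d)%R).
  exact: measurableT_comp mf (measurable_shift d).
(* Half-open intervals can be glued disjointly, and the endpoint dropped has measure zero. *)
rewrite -!integral_itv_bndo_bndc; [|exact: measurable_funTS|exact: measurable_funTS].
rewrite ge0_integral_itv_shift// add0r.
have spl (a b e : R) : (a <= b)%R -> (b <= e)%R ->
    \int[mu]_(x in `[a, e[) f x = \int[mu]_(x in `[a, b[) f x + \int[mu]_(x in `[b, e[) f x.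
  move=> ab be; have -> : `[a, e[%classic = `[a, b[ `|` `[b, e[ :> set R.
    apply/seteqP; split => x /=; rewrite !in_itv /=.
      by move=> /andP[ax xe]; have [xb|bx] := ltP x b; [left|right]; rewrite ?ax ?bx.
    by move=> [] /andP[h1 h2]; apply/andP; split; lra.
  rewrite ge0_integral_setU//; first exact: measurable_funTS.
  rewrite disj_set2E; apply/eqP/seteqP; split => // x /= []; rewrite !in_itv /=.
  by move=> /andP[_ h1] /andP[h2 _]; move: (lt_le_trans h1 h2); rewrite ltxx.
rewrite (spl d twopi (twopi + d)%R) ?lerDl ?(ltW d1)//.
rewrite (spl 0%R d twopi) ?(ltW d1)// addeC; congr (_ + _).
rewrite -[X in `[X, _[](add0r twopi) [(twopi + d)%R]addrC -ge0_integral_itv_shift//.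
by apply: eq_integral => x _; rewrite -(fp x 1%R) mulr1.
Qed.

Lemma tnth_tuple_cons0 n x (t : n.-tuple MR) : tnth (tuple_cons (x, t)) ord0 = x.
Proof. by rewrite (tnth_nth 0%R). Qed.

Lemma tnth_tuple_consS n x (t : n.-tuple MR) k :
  tnth (tuple_cons (x, t)) (lift ord0 k) = tnth t k.
Proof. by rewrite !(tnth_nth 0%R). Qed.

Lemma preimage_angles n : @tuple_cons R n @^-1` angles = `[0%R, twopi]%classic `*` angles.
Proof.
apply/seteqP; split => -[x t] /=.
  move=> h; split; first by have := h ord0; rewrite tnth_tuple_cons0 ?in_itv.
  by move=> j; have := h (lift ord0 j); rewrite tnth_tuple_consS.
move=> [x01 ht] j; case: (unliftP ord0 j) => [k ->|->].
  by rewrite tnth_tuple_consS.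
by rewrite tnth_tuple_cons0; move: x01; rewrite ?in_itv.
Qed.

Lemma measurable_angles n : measurable (@angles R n).
Proof.
rewrite (_ : angles = \bigcap_(j in [set: 'I_n]) ((@tnth n MR)^~ j @^-1` `[0%R, twopi]%classic)).
  apply: fin_bigcap_measurable => // j _; rewrite -[X in measurable X]setTI.
  by apply: (measurable_tnth j).
apply/seteqP; split => t /= h j.
  by move=> _ /=; rewrite in_itv /=; exact: h.
by have := h j I; rewrite /= in_itv.
Qed.

Lemma lebesgue_tuple_angles n : lebesgue_tuple n (@angles R n) < +oo.
Proof.
elim: n => [|n IH]; first by rewrite /= diracE; case: (_ \in _); rewrite ltry.
rewrite /= /lebesgue_cons /pushforward preimage_angles product_measure1E//=; last first.
  exact: measurable_angles.
rewrite lte_mul_pinfty// lebesgue_measure_itv /= lte_fin mulr_gt0 ?pi_gt0//.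
Qed.

Lemma ge0_integral_lebesgue_cons n (f : n.+1.-tuple MR -> \bar R) :
  measurable_fun setT f -> (forall t, 0 <= f t) ->
  \int[lebesgue_tuple n.+1]_(t in angles) f t =
  \int[mu]_(x in `[0%R, twopi]) \int[lebesgue_tuple n]_(t in angles) f (tuple_cons (x, t)).
Proof.
move=> mf f0; rewrite /= /lebesgue_cons.
rewrite (ge0_integral_pushforward (@measurable_tuple_cons R n)); last 3 first.
- exact: measurable_angles.
- exact: measurable_funTS.
- by move=> t _.
have mIA : measurable (`[0%R, twopi]%classic `*` @angles R n : set (MR * n.-tuple MR)).
  by apply: measurableX => //; exact: measurable_angles.
rewrite preimage_angles integral_mkcond fubini_tonelli1; last 2 first.
- apply: (measurable_restrictT _ mIA).1.
  by apply: measurable_funTS; exact: measurableT_comp mf (@measurable_tuple_cons R n).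
- by move=> x; rewrite patchE; case: ifP => //= _; exact: f0.
rewrite [RHS]integral_mkcond; apply: eq_integral => x _; rewrite /fubini_F [RHS]patchE.
case: ifPn => xI.
  rewrite [RHS]integral_mkcond; apply: eq_integral => t _; rewrite !patchE.
  have -> // : ((x, t) \in `[0%R, twopi]%classic `*` angles) = (t \in angles).
  apply/idP/idP => /set_mem; first by move=> [_ /mem_set].
  by move=> h; apply/mem_set; split => //; exact: set_mem.
rewrite integral0_eq// => t _; rewrite patchE; case: ifP => // /set_mem[/mem_set].
by rewrite (negbTE xI).
Qed.

Definition tuple_shift n (c : 'I_n -> R) (t : n.-tuple MR) : n.-tuple MR :=
  [tuple (tnth t j + c j)%R | j < n].

Lemma measurable_tuple_shift n (c : 'I_n -> R) : measurable_fun setT (tuple_shift c).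
Proof.
apply/measurable_fun_tnthP => j.
rewrite (_ : _ \o _ = (fun x : MR => (x + c j)%R : MR) \o (@tnth n MR)^~ j); last first.
  by apply/funext => t /=; rewrite /tuple_shift tnth_mktuple.
exact: measurableT_comp (measurable_shift _) (measurable_tnth j).
Qed.

Definition torus_periodic n T (f : n.-tuple MR -> T) := forall t t' : n.-tuple MR,
  (forall j, exists m : int, tnth t' j = (tnth t j + twopi * m%:~R)%R) -> f t' = f t.

(** Induction on the dimension: for each fixed head the induction hypothesis shifts the tail, and
    the inner integral is itself periodic in the head. *)
Lemma ge0_integral_tuple_shift n (f : n.-tuple MR -> \bar R) (c : 'I_n -> R) :
  measurable_fun setT f -> (forall t, 0 <= f t) -> torus_periodic f ->
  \int[lebesgue_tuple n]_(t in angles) f (tuple_shift c t) =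
  \int[lebesgue_tuple n]_(t in angles) f t.
Proof.
elim: n f c => [|n IH] f c mf f0 fp.
  by apply: eq_integral => t _; rewrite [tuple_shift c t]tuple0 [t in RHS]tuple0.
have mcons (x : MR) : measurable_fun setT (fun t : n.-tuple MR => tuple_cons (x, t)).
  exact: measurableT_comp (@measurable_tuple_cons R n) (pair1_measurable x).
have mg : measurable_fun [set: MR]
    (fun x => \int[lebesgue_tuple n]_(t in angles) f (tuple_cons (x, t))).
  (* The cut-off concerns the tail only, so that the inner integral is measurable on the whole line,
     as the shift of the head requires. *)
  pose g := (fun z : MR * n.-tuple MR => f (tuple_cons z)) \_ (setT `*` angles).
  have -> : (fun x => \int[lebesgue_tuple n]_(t in angles) f (tuple_cons (x, t))) =
      fubini_F (lebesgue_tuple n) g.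
    apply/funext => x; rewrite integral_mkcond; apply: eq_integral => t _.
    rewrite /g !patchE; have -> // : ((x, t) \in setT `*` angles) = (t \in angles).
    by apply/idP/idP => /set_mem h; apply/mem_set => //; case: h.
  apply: measurable_fun_fubini_tonelli_F.
    have mA : measurable (setT `*` @angles R n : set (MR * n.-tuple MR)).
      by apply: measurableX => //; exact: measurable_angles.
    apply: (measurable_restrictT _ mA).1.
    by apply: measurable_funTS; exact: measurableT_comp mf (@measurable_tuple_cons R n).
  by move=> x; rewrite /g patchE; case: ifP.
rewrite !ge0_integral_lebesgue_cons//; last first.
  exact: measurableT_comp mf (measurable_tuple_shift c).
rewrite -[RHS](ge0_integral_period_shift (c ord0) mg).
- apply: eq_integral => x _.
  rewrite -[RHS](IH _ (fun j => c (lift ord0 j))).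
  + apply: eq_integral => t _; congr f; apply: eq_from_tnth => j.
    rewrite tnth_mktuple; case: (unliftP ord0 j) => [k ->|->].
      by rewrite !tnth_tuple_consS tnth_mktuple.
    by rewrite !tnth_tuple_cons0.
  + exact: measurableT_comp mf (mcons _).
  + by [].
  + move=> t t' h; apply: fp => j; case: (unliftP ord0 j) => [k ->|->].
      by have [m hm] := h k; exists m; rewrite !tnth_tuple_consS.
    by exists 0%R; rewrite !tnth_tuple_cons0 mulr0 addr0.
- by move=> x; apply: integral_ge0.
- move=> x m; apply: eq_integral => t _; apply: fp => j.
  case: (unliftP ord0 j) => [k ->|->].
    by exists 0%R; rewrite !tnth_tuple_consS mulr0 addr0.
  by exists m; rewrite !tnth_tuple_cons0.
Qed.

Local Close Scope ereal_scope.

Definition bounded_measurable n (f : n.-tuple MR -> R) :=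
  measurable_fun setT f /\ exists M, forall t, `|f t| <= M.

Lemma bounded_measurable_integrable n (f : n.-tuple MR -> R) : bounded_measurable f ->
  (lebesgue_tuple n).-integrable angles (EFin \o f).
Proof.
move=> [mf [M fM]]; apply: measurable_bounded_integrable.
- exact: measurable_angles.
- exact: lebesgue_tuple_angles.
- exact: measurable_funTS.
- exists M; split; first exact: num_real.
  by move=> x Mx t _ /=; apply: le_trans (fM t) (ltW Mx).
Qed.

Lemma bounded_measurable_shift n (f : n.-tuple MR -> R) c : bounded_measurable f ->
  bounded_measurable (fun t => f (tuple_shift c t)).
Proof.
move=> [mf [M fM]]; split; last by exists M.
exact: measurableT_comp mf (measurable_tuple_shift c).
Qed.

Lemma Rintegral_tuple_shift n (f : n.-tuple MR -> R) (c : 'I_n -> R) :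
  bounded_measurable f -> torus_periodic f ->
  \int[lebesgue_tuple n]_(t in angles) f (tuple_shift c t) =
  \int[lebesgue_tuple n]_(t in angles) f t.
Proof.
move=> bf fp; have [mf [M fM]] := bf.
have bM : bounded_measurable (fun _ : n.-tuple MR => M) by split => //; exists `|M|.
have mA := @measurable_angles n.
(* Adding the bound M makes the integrand nonnegative; its integral is finite and cancels. *)
suff h : \int[lebesgue_tuple n]_(t in angles) (f (tuple_shift c t) + M) =
         \int[lebesgue_tuple n]_(t in angles) (f t + M).
  apply: (addIr (\int[lebesgue_tuple n]_(t in angles) M)).
  rewrite -!RintegralD//; [exact: bounded_measurable_integrable
    |exact: bounded_measurable_integrable|apply: bounded_measurable_integrable
    |exact: bounded_measurable_integrable].
  exact: bounded_measurable_shift.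
congr fine; apply: (@ge0_integral_tuple_shift _ (fun t => (f t + M)%:E)).
- by apply/measurable_EFinP; exact: measurable_funD.
- move=> t; rewrite lee_fin; have := fM t; rewrite ler_norml => /andP[]; lra.
- by move=> t t' /fp ->.
Qed.

End TorusIntegral.

(** * The Mahler measure of the pencil *)

Section MahlerPencil.
Context {R : realType} {n : nat}.
Local Notation C := R[i].
Local Notation MR := (measurableTypeR R).
Implicit Types (P : laurent R n) (u v t : 'I_n -> R) (d : 'I_n -> int) (k : C).

Definition log_pencil P k u t : R := ln (normc (k - polar_eval P u t)).

(** Multiplication of the coordinates by y^(d_j): with s acting on the logarithms of the moduli and
    f on the arguments, y is [polar s f]. *)
Definition translate d (s : R) u : 'I_n -> R := fun j => u j + s * (d j)%:~R.

Definition int_pairing (m : {ffun 'I_n -> int}) d : int := \sum_j m j * d j.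

Lemma pairing_translate m d s u : pairing m (translate d s u) = pairing m u + s * (int_pairing m d)%:~R.
Proof.
rewrite /int_pairing rmorph_sum mulr_sumr -big_split; apply: eq_bigr => j _ /=.
by rewrite /translate intrM; ring.
Qed.

Lemma polar_eval_translate P d u t s f : polar_eval P (translate d s u) (translate d f t) =
  \sum_(m <- msupp P) P@_m * polar (pairing m u) (pairing m t) * polar s f ^ int_pairing m d.
Proof.
apply: eq_bigr => m _; rewrite !pairing_translate polarD polar_exprz mulrA.
by rewrite ![_%:~R * _]mulrC.
Qed.

Lemma polar_eval_period P u t t' : (forall j, exists m : int, t' j = t j + 2 * pi * m%:~R) ->
  polar_eval P u t' = polar_eval P u t.
Proof.
move=> /choice [d hd]; have -> : t' = translate d (2 * pi) t by apply/funext => j; rewrite hd.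
by apply: eq_bigr => m _; rewrite pairing_translate polar_period.
Qed.

(** On the monomial curve through (u, t), the circles |y| = 1 and |y| = e^h lie over the two tori
    where [escape] holds. Both discs then contain D roots of the numerator Q, and [mean_ln_annulus]
    applies. The sample points are N-th roots of unity, that is, rotations of t along d. *)
Lemma log_pencil_annulus P k d u h t e : 0 < h ->
  escape (range (polar_eval P u)) k ->
  escape (range (polar_eval P (translate d h u))) k -> 0 < e ->
  exists N0, forall N, (N0 <= N)%N -> (0 < N)%N ->
  `|\sum_(i < N) (log_pencil P k (translate d h u) (translate d (i%:R * (2 * pi / N%:R)) t) -
                  log_pencil P k u (translate d (i%:R * (2 * pi / N%:R)) t))| <= e.
Proof.
move=> h0 esc0 esch e0.
(* One exponent clearing the negative powers of y in all monomials at once. *)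
pose D := (\sum_(m <- msupp P) absz (int_pairing m d))%N.
have De m : m \in msupp P -> 0 <= int_pairing m d + D%:Z.
  move=> mP; have h1 : (absz (int_pairing m d) <= D)%N.
    by rewrite /D (big_rem m)//= leq_addr.
  by lia.
pose Q : {poly C} := k *: 'X^D - \sum_(m <- msupp P)
  (P@_m * polar (pairing m u) (pairing m t)) *: 'X^(absz (int_pairing m d + D%:Z)).
have QE s f : Q.[polar s f] =
    polar s f ^+ D * (k - polar_eval P (translate d s u) (translate d f t)).
  rewrite hornerD hornerN hornerZ hornerXn horner_sum polar_eval_translate mulrBr mulrC.
  congr (_ - _); rewrite mulr_sumr; apply: eq_big_seq => m mP.
  rewrite hornerZ hornerXn [RHS]mulrCA; congr (_ * _).
  have xu : polar s f \is a GRing.unit by rewrite unitfE polar_neq0.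
  by rewrite !exprnP gez0_abs ?De// -expfzDr ?polar_neq0// addrC.
have tr0 : translate d 0 u = u by apply/funext => j; rewrite /translate mul0r addr0.
have roots s : escape (range (polar_eval P (translate d s u))) k -> nroots Q (expR s) = D.
  move=> esc; apply: (escape_nroots (expR_gt0 s) esc) => x /polar_surj [f [_ ->]].
  by exists (polar_eval P (translate d s u) (translate d f t)).
have nz s : escape (range (polar_eval P (translate d s u))) k ->
    forall x, normc x = expR s -> Q.[x] != 0.
  move=> esc x /polar_surj [f [_ ->]]; rewrite QE mulf_neq0 ?expf_neq0 ?polar_neq0//.
  have [c c0 /(_ _ (imageP _ I))] := escape_margin esc.
  by move=> /(_ (translate d f t)) hc; rewrite -normc_gt0 (lt_le_trans c0).
have esc0' : escape (range (polar_eval P (translate d 0 u))) k by rewrite tr0.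
(* The factor y^D contributes D s, which is the term D ln r subtracted in [mean_ln_annulus]. *)
have lnQ s f : escape (range (polar_eval P (translate d s u))) k ->
    ln (normc Q.[polar s f]) = D%:R * s + log_pencil P k (translate d s u) (translate d f t).
  move=> esc; have := nz s esc (polar s f) (normc_polar _ _).
  rewrite QE mulf_eq0 negb_or => /andP[_ k0].
  rewrite normcM normcX normc_polar lnM ?posrE ?normc_gt0// ?exprn_gt0 ?expR_gt0//.
  by rewrite lnXn ?expR_gt0// expRK mulr_natl.
have [] := @mean_ln_annulus R Q D (expR h) e; rewrite ?roots//.
- by rewrite expR_gt1.
- by rewrite -expR0 roots.
- by move=> x x1; apply: (nz 0) => //; rewrite expR0.
- exact: nz.
move=> N0 H; exists N0 => N /H {}H /H; apply: le_trans.
rewrite sumrB le_eqVlt; apply/orP; left; apply/eqP; congr (`|_ - _|).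
  apply: eq_bigr => i _; have -> : (expR h)%:C * unity_gen N ^+ i =
      polar h (i%:R * (2 * pi / N%:R)) :> C.
    rewrite polar_exprn -[X in X * _]mulr1 -[h in RHS]addr0 -[RHS]mulr1.
    by rewrite /polar mulr0 addr0 expR0 mul1r !mulr1.
  by rewrite lnQ// expRK; ring.
apply: eq_bigr => i _; rewrite polar_exprn mulr0 lnQ// mulr0 add0r tr0//.
Qed.

Lemma measurable_log_pencil P k u :
  measurable_fun setT (fun t : n.-tuple MR => log_pencil P k u (tnth t)).
Proof.
have mp m : measurable_fun setT (fun t : n.-tuple MR => pairing m (tnth t)).
  apply: measurable_sum => j; apply: measurable_funM; first exact: measurable_cst.
  exact: measurable_tnth.
have mc m : measurable_fun setT (fun t : n.-tuple MR => cos (pairing m (tnth t))).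
  apply: measurableT_comp (mp m); apply: continuous_measurable_fun; exact: continuous_cos.
have ms m : measurable_fun setT (fun t : n.-tuple MR => sin (pairing m (tnth t))).
  apply: measurableT_comp (mp m); apply: continuous_measurable_fun; exact: continuous_sin.
have cM (c : R) (f : n.-tuple MR -> R) : measurable_fun setT f ->
    measurable_fun setT (fun x => c * f x).
  by move=> mf; apply: measurable_funM => //; exact: measurable_cst.
have ReB (x y : C) : complex.Re (x - y) = complex.Re x - complex.Re y by case: x; case: y.
have ImB (x y : C) : complex.Im (x - y) = complex.Im x - complex.Im y by case: x; case: y.
have mre : measurable_fun setT (fun t : n.-tuple MR => complex.Re (k - polar_eval P u (tnth t))).
  under eq_fun do rewrite ReB Re_polar_eval.
  apply: measurable_funB; first exact: measurable_cst.
  apply: measurable_sum => m; apply: (cM); apply: measurable_funB; exact: cM.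
have mim : measurable_fun setT (fun t : n.-tuple MR => complex.Im (k - polar_eval P u (tnth t))).
  under eq_fun do rewrite ImB Im_polar_eval.
  apply: measurable_funB; first exact: measurable_cst.
  apply: measurable_sum => m; apply: (cM); apply: measurable_funD; exact: cM.
apply: measurableT_comp; first exact: measurable_ln.
rewrite (_ : (fun t : n.-tuple MR => _) = (@Num.sqrt R) \o (fun t : n.-tuple MR =>
  complex.Re (k - polar_eval P u (tnth t)) ^+ 2 + complex.Im (k - polar_eval P u (tnth t)) ^+ 2));
  last by apply/funext => t /=; case: (k - _).
apply: measurableT_comp; first by apply: continuous_measurable_fun; exact: sqrt_continuous.
by apply: measurable_funD; apply: measurable_funX.
Qed.

(** The margin keeps |k - P| away from 0, so the logarithm has no singularity on the torus. *)
Lemma bounded_log_pencil P k u : escape (range (polar_eval P u)) k ->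
  exists M, forall t, `|log_pencil P k u t| <= M.
Proof.
move=> /escape_margin [c c0 hc].
pose B := normc k + \sum_(m <- msupp P) normc P@_m * expR (pairing m u).
exists (`|ln c| + `|ln B|) => t; rewrite /log_pencil.
have h1 := hc _ (imageP _ (I : setT t)).
have h2 : normc (k - polar_eval P u t) <= B.
  by apply: le_trans (ler_normcB _ _) _; rewrite lerD2l normc_polar_eval_le.
have p1 := lt_le_trans c0 h1; have p2 := lt_le_trans p1 h2.
have l1 : ln c <= ln (normc (k - polar_eval P u t)) by rewrite ler_ln ?posrE.
have l2 : ln (normc (k - polar_eval P u t)) <= ln B by rewrite ler_ln ?posrE.
have := ler_norm (ln B); have := ler_norm (- ln c); rewrite normrN.
have := normr_ge0 (ln B); have := normr_ge0 (ln c).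
rewrite ler_norml => *; apply/andP; split; lra.
Qed.

Lemma bounded_measurable_log_pencil P k u : escape (range (polar_eval P u)) k ->
  bounded_measurable (fun t : n.-tuple MR => log_pencil P k u (tnth t)).
Proof.
move=> /bounded_log_pencil [M hM]; split; first exact: measurable_log_pencil.
by exists M => t.
Qed.

Definition log_integral P k u : R :=
  \int[lebesgue_tuple n]_(t in angles) log_pencil P k u (tnth t).

Lemma mahler_pencil P k (a : 'I_n -> R) : (forall j, 0 < a j) ->
  mahler a (laurent_eval (pencil P k)) =
  (2 * pi) ^- n * log_integral P k (fun j => ln (a j)).
Proof.
move=> a0; congr (_ * _); apply: eq_Rintegral => t _; rewrite /log_pencil.
rewrite laurent_eval_pencil -laurent_eval_polar; congr (ln (normc (_ - laurent_eval _ _))).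
by apply/funext => j; rewrite /torus_point /polar lnK ?posrE.
Qed.

Lemma bounded_measurableB (f g : n.-tuple MR -> R) : bounded_measurable f ->
  bounded_measurable g -> bounded_measurable (fun x => f x - g x).
Proof.
move=> [mf [A hA]] [mg [B hB]]; split; first exact: measurable_funB.
by exists (A + B) => t; apply: le_trans (ler_normB _ _) _; rewrite lerD.
Qed.

Lemma bounded_measurable_sum (I : Type) (s : seq I) (f : I -> n.-tuple MR -> R) :
  (forall i, bounded_measurable (f i)) -> bounded_measurable (fun x => \sum_(i <- s) f i x).
Proof.
move=> bf; elim: s => [|i s [mg [B hB]]].
  by under eq_fun do rewrite big_nil; split => //; exists 0 => t; rewrite normr0.
have [mf [A hA]] := bf i; under eq_fun do rewrite big_cons.
split; first exact: measurable_funD.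
by exists (A + B) => t; apply: le_trans (ler_normD _ _) _; rewrite lerD.
Qed.

Lemma Rintegral_sum (I : Type) (s : seq I) (f : I -> n.-tuple MR -> R) :
  (forall i, bounded_measurable (f i)) ->
  \int[lebesgue_tuple n]_(t in angles) (\sum_(i <- s) f i t) =
  \sum_(i <- s) \int[lebesgue_tuple n]_(t in angles) f i t.
Proof.
move=> bf; elim: s => [|i s IH].
  under eq_Rintegral do rewrite big_nil.
  by rewrite big_nil Rintegral_cst ?mul0r//; exact: measurable_angles.
under eq_Rintegral do rewrite big_cons.
rewrite big_cons RintegralD ?IH//; first exact: measurable_angles.
  exact: bounded_measurable_integrable.
by apply: bounded_measurable_integrable; exact: bounded_measurable_sum.
Qed.

(** Averaging the difference F of the integrands over rotations along d leaves its integral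
    unchanged, while the averages tend to 0 pointwise by [log_pencil_annulus]. They inherit the
    bound of F, so dominated convergence applies. *)
Lemma log_integral_translate P k d u h : 0 < h ->
  escape (range (polar_eval P u)) k ->
  escape (range (polar_eval P (translate d h u))) k ->
  log_integral P k (translate d h u) = log_integral P k u.
Proof.
move=> h0 esc0 esch.
pose f w (t : n.-tuple MR) := log_pencil P k w (tnth t).
have b0 : bounded_measurable (f u) := bounded_measurable_log_pencil esc0.
have bh : bounded_measurable (f (translate d h u)) := bounded_measurable_log_pencil esch.
have per w : torus_periodic (f w).
  by move=> t t' tt'; rewrite /f /log_pencil (polar_eval_period _ _ tt').
pose F (t : n.-tuple MR) := f (translate d h u) t - f u t.
have bF : bounded_measurable F by exact: bounded_measurableB.
have perF : torus_periodic F by move=> t t' tt'; rewrite /F !(per _ _ _ tt').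
pose c (N i : nat) (j : 'I_n) : R := i%:R * (2 * pi / N%:R) * (d j)%:~R.
pose G N (t : n.-tuple MR) := N.+1%:R^-1 * \sum_(i < N.+1) F (tuple_shift (c N.+1 i) t).
have bS N : bounded_measurable (fun x => \sum_(i < N.+1) F (tuple_shift (c N.+1 i) x)).
  by apply: bounded_measurable_sum => i; exact: bounded_measurable_shift.
have mA := @measurable_angles R n.
have intF : \int[lebesgue_tuple n]_(t in angles) F t =
    log_integral P k (translate d h u) - log_integral P k u.
  by rewrite RintegralB//; exact: bounded_measurable_integrable.
have intG N : \int[lebesgue_tuple n]_(t in angles) G N t =
    \int[lebesgue_tuple n]_(t in angles) F t.
  rewrite RintegralZl//; last exact: bounded_measurable_integrable.
  rewrite Rintegral_sum; last by move=> i; exact: bounded_measurable_shift.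
  under eq_bigr do rewrite Rintegral_tuple_shift//.
  by rewrite sumr_const card_ord -[X in _ * X]mulr_natl mulKf.
have [_ [M hM]] := bF.
have GM N (t : n.-tuple MR) : `|G N t| <= M.
  rewrite normrM ger0_norm ?invr_ge0// ler_pdivrMl ?ltr0n//.
  apply: le_trans (ler_norm_sum _ _ _) _; rewrite mulr_natl.
  by rewrite -[X in _ *+ X]card_ord -sumr_const; apply: ler_sum.
have bG N : bounded_measurable (G N).
  split; last by exists M.
  by apply: measurable_funM; [exact: measurable_cst|case: (bS N)].
have Gcvg (t : n.-tuple MR) : (G N t)%:E @[N --> \oo] --> 0%E.
  apply: cvg_EFin; first by apply: nearW.
  apply/cvgrPdist_le => e e0.
  have [N0 H] := log_pencil_annulus (tnth t) h0 esc0 esch e0.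
  exists N0 => // N /= N0N; rewrite sub0r normrN.
  rewrite /G normrM ger0_norm ?invr_ge0// ler_pdivrMl ?ltr0n//.
  (* The sum itself is at most e, so the division by N + 1 is harmless. *)
  apply: le_trans (_ : e <= _); last by rewrite ler_peMl ?(ltW e0)// ler1n.
  apply: le_trans (H N.+1 (leqW N0N) isT); rewrite le_eqVlt; apply/orP; left.
  apply/eqP; congr `|_|; apply: eq_bigr => i _.
  have E : tnth (tuple_shift (c N.+1 i) t) =
      translate d (i%:R * (2 * pi / N.+1%:R)) (tnth t).
    by apply/funext => j; rewrite tnth_mktuple.
  by rewrite /F /f E.
have [] := @dominated_convergence _ _ R (lebesgue_tuple n) angles mA
  (fun N x => (G N x)%:E) (cst 0%E) (EFin \o cst M).
- by move=> N; apply: measurable_funTS; apply/measurable_EFinP; case: (bG N).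
- exact: measurable_cst.
- by apply: aeW => t _; exact: Gcvg.
- by apply: bounded_measurable_integrable; split => //; exists `|M|.
- by apply: aeW => t N _; rewrite /= lee_fin.
move=> _ _; rewrite integral0.
(* The integrals form a constant sequence, whose limit is 0. *)
have -> : (fun N => (\int[lebesgue_tuple n]_(t in angles) (G N t)%:E)%E) =
    cst (\int[lebesgue_tuple n]_(t in angles) F t)%:E.
  apply/funext => N; rewrite -(intG N) /Rintegral fineK//.
  by apply: integrable_fin_num => //; exact: bounded_measurable_integrable.
rewrite intF => cvg0.
have /eqP : (log_integral P k (translate d h u) - log_integral P k u)%:E = 0%E.
  move: (_ - _) cvg0 => x; move: (x%:E) => y cvg0.
  have cy : cst y @ \oo --> y by exact: cvg_cst.
  exact: cvg_unique cy cvg0.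
by rewrite eqe subr_eq0 => /eqP.
Qed.

Lemma log_integral_escape P k u : escape (range (polar_eval P u)) k ->
  escape (range (polar_eval P (fun=> 0))) k ->
  log_integral P k u = log_integral P k (fun=> 0).
Proof.
move=> escu esc0; set z := fun=> 0 : R.
have [c c0 hc] := escape_margin esc0.
have [dl dl0 hdl] := escape_perturb esc0.
pose V := fine (lebesgue_tuple n (@angles R n)).
have V0 : 0 <= V by exact: fine_ge0.
apply/eqP; rewrite -subr_eq0 -normr_le0; apply/ler_addgt0Pl => e e0; rewrite addr0.
(* The integrands will differ by at most 2 q on a set of measure V, and 2 q V <= e V / (V + 1) <= e;
   [ln_near1] asks for q <= 1/2. *)
pose q := Num.min (1 / 2) (e / (2 * (V + 1))).
have V1 : 0 < 2 * (V + 1) by lra.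
have q0 : 0 < q by rewrite lt_min; apply/andP; split; [lra|rewrite divr_gt0].
have [q1 q2] : q <= 1 / 2 /\ q <= e / (2 * (V + 1)) by rewrite /q !ge_min !lexx orbT.
(* [dl] keeps k joined to infinity; q c, where c is the margin of k, puts the ratio of the two
   moduli within q of 1. *)
have eta0 : 0 < Num.min dl (q * c) by rewrite lt_min dl0 mulr_gt0.
have [s s0 hs] := polar_eval_perturb P z eta0.
(* Rounding down leaves a remainder in [0, s), however large u is. *)
pose d j := Num.floor (u j / s).
pose v : 'I_n -> R := fun j => u j - s * (d j)%:~R.
have uv : u = translate d s v by apply/funext => j; rewrite /translate /v subrK.
have vs j : `|v j| <= s.
  have /andP[] := Num.Theory.floor_itv (u j / s).
  rewrite -/(d j) ler_pdivlMr// ltr_pdivrMr// intrD mulrDl mul1r /v mulrC => h1 h2.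
  by rewrite ger0_norm; lra.
have zv : z \+ v = v by apply/funext => j; rewrite /= add0r.
have close t : normc (polar_eval P v t - polar_eval P z t) <= Num.min dl (q * c).
  by rewrite -[X in polar_eval P X t - _]zv; exact: hs.
have escv : escape (range (polar_eval P v)) k.
  apply: hdl => _ [t _ <-]; exists (polar_eval P z t); first by exists t.
  by rewrite normcBC; apply: le_trans (close t) _; rewrite ge_min lexx.
rewrite uv log_integral_translate -?uv//.
have bv := bounded_measurable_log_pencil escv.
have bz := bounded_measurable_log_pencil esc0.
have mA := @measurable_angles R n.
rewrite -RintegralB//; [|exact: bounded_measurable_integrable|exact: bounded_measurable_integrable].
have bB := bounded_measurableB bv bz.
apply: le_trans (le_normr_Rintegral _ _) _ => //; first exact: bounded_measurable_integrable.
apply: (@le_trans _ _ (\int[lebesgue_tuple n]_(t in @angles R n) (2 * q))).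
  apply: le_Rintegral => //.
  - have [mB [M hM]] := bB; apply: bounded_measurable_integrable; split.
      exact: measurableT_comp.
    by exists M => t; rewrite normr_id.
  - by apply: bounded_measurable_integrable; split => //; exists `|2 * q|.
  move=> t _; have h0 := hc _ (imageP _ (I : setT (tnth t))).
  have p0 := lt_le_trans c0 h0.
  set x := k - polar_eval P z (tnth t) in h0 p0 *.
  have dist : `|normc (k - polar_eval P v (tnth t)) - normc x| <= q * c.
    have := close (tnth t); rewrite le_min => /andP[_ hq].
    have E : x - (k - polar_eval P v (tnth t)) = polar_eval P v (tnth t) - polar_eval P z (tnth t).
      by rewrite /x; ring.
    have h1 := lerB_normc x (k - polar_eval P v (tnth t)).
    have h2 := lerB_normc (k - polar_eval P v (tnth t)) x.
    rewrite (normcBC _ x) in h2; rewrite E in h1 h2.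
    move: (normc x) (normc (k - _)) (normc (_ - _)) h1 h2 hq => X Y Z *.
    by rewrite ler_norml; apply/andP; split; lra.
  have y0 : 0 < normc (k - polar_eval P v (tnth t)).
    have qc : q * c <= 1 / 2 * c by rewrite ler_pM2r.
    move: dist; rewrite ler_norml => /andP[h1 _]; lra.
  rewrite /log_pencil -/x -ln_div ?posrE//; apply: ln_near1 => //.
  rewrite -[X in _ - X](divff (lt0r_neq0 p0)) -mulrBl normrM normfV (gtr0_norm p0).
  by rewrite ler_pdivrMr//; apply: le_trans dist _; rewrite ler_pM2l.
rewrite Rintegral_cst// -/V.
apply: (@le_trans _ _ (2 * (e / (2 * (V + 1))) * V)); first by rewrite ler_wpM2r// ler_pM2l.
have -> : 2 * (e / (2 * (V + 1))) * V = e * (V / (V + 1)).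
  by field; apply: lt0r_neq0; lra.
by rewrite ler_piMr ?(ltW e0)// ler_pdivrMr; lra.
Qed.

(** On the circle of radius a_j the slice takes values of k - P on the torus, only the j-th argument
    moving. *)
Lemma nu_escape P (a : 'I_n -> R) k j : (forall i, 0 < a i) ->
  escape (range (polar_eval P (fun i => ln (a i)))) k -> nu P a k j = 0.
Proof.
move=> a0 esc; apply: (escape_zeros_minus_poles (a0 j) esc) => x nx.
have [|f [_ xE]] := @polar_surj R x (ln (a j)); first by rewrite nx lnK ?posrE.
(* The slice fixes the other variables at the positive reals a_i, hence argument 0. *)
pose t i := if i == j then f else 0.
exists (polar_eval P (fun i => ln (a i)) t); first by exists t.
rewrite -laurent_eval_polar -laurent_eval_pencil.
rewrite /laurent_slice raddf_sum; apply: eq_bigr => m _.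
rewrite /= mmapU.
have E (y : 'I_n -> C) : y j = x -> (forall i, i != j -> y i = (a i)%:C) ->
    \prod_i y i ^ m i = x ^ m j * \prod_(i < n | i != j) (a i)%:C ^ m i.
  move=> yj yi; rewrite (bigD1 j)//= yj; congr (_ * _).
  by apply: eq_bigr => i /yi ->.
rewrite [RHS](congr1 ( *%R _) (E _ _ _)) /=.
- by move: (\prod_(i < n | i != j) _) => B; rewrite mulrA mulrAC.
- by rewrite /t eqxx.
- by move=> i ij; rewrite /t (negbTE ij) /polar cos0 sin0 mulr1 lnK ?posrE.
Qed.

End MahlerPencil.

Theorem theorem7p1 (R : realType) (n : nat) (hn : (1 <= n)%N)
    (a : 'I_n -> R) (ha : forall j, 0 < a j)
    (P : laurent R n) (hP : P@_(0 : {ffun 'I_n -> int}) = 0) :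
  let one : 'I_n -> R := fun=> 1 in
  let Ua := unbounded_component (torus_image P a) in
  let U1 := unbounded_component (torus_image P one) in
  (forall k : R[i], (Ua `&` U1) k ->
     mahler a (laurent_eval (pencil P k)) =
     mahler one (laurent_eval (pencil P k))
     + \sum_(j < n) (nu P a k j)%:~R * ln (a j)) /\
  (forall j : 'I_n, exists nu_j : int,
     forall k : R[i], (Ua `&` U1) k -> nu P a k j = nu_j).
Proof.
move=> one Ua U1.
have one0 j : 0 < one j by rewrite ltr01.
have nu0 k j : Ua k -> nu P a k j = 0.
  by move=> kU; apply: nu_escape => //; exact: torus_escape.
split=> [k [ka k1]|j]; last by exists 0 => k [ka _]; exact: nu0.
rewrite big1 ?addr0; last by move=> j _; rewrite nu0// mul0r.
have one_ln : (fun j => ln (one j)) = (fun=> 0) by apply/funext => j; rewrite ln1.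
rewrite (mahler_pencil P k ha) (mahler_pencil P k one0) one_ln.
have esc1 := torus_escape one0 k1; rewrite one_ln in esc1.
by rewrite (log_integral_escape (torus_escape ha ka) esc1).
Qed.
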